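(* Let $k\in\{1,2,3,4\}$. There exist constants $c_k$ and $C_k$ depending only on $k$ such that the following holds. Let $n>k$, let $f^0\in\mathbb{R}^n$ and $Y\sim\mathcal{N}_n(f^0,I)$, and let $S=\{t_1,\ldots,t_s\}\subseteq[k+1:n]$ with $k+1\le t_1<\cdots<t_s\le n$ be fixed but arbitrary. Let $u>0$ be arbitrary and let the tuning parameter $\lambda$ satisfy $$\lambda\ \ge\ c_k\,n^{k-1}\Bigl(\frac{n_{\max}}{2n}\Bigr)^{\frac{2k-1}{2}}\lambda_0(u),\qquad \lambda_0(u):=\sqrt{\frac{2\log(2(n-k-s))+2u}{n}} .$$ Let $f\in\mathbb{R}^n$ be arbitrary and define the signs $q_{t_i}:=\mathrm{sign}\bigl((\Delta(k)f)_{t_i}\bigr)\in\{-1,+1\}$, $i\in[1:s]$, and $$S^{\pm}:=\{i\in[2:s]:\ q_{t_i}q_{t_{i-1}}=-1\}\cup\{1,s+1\}.$$ Assume $n_i\ge k(k+2)$ for all $i\in S^{\pm}$. Finally, let $v>0$ be arbitrary. Then with probability at least $1-e^{-u}-e^{-v}$ we have $$\|\hat f-f^0\|_n^2\ \le\ \|f-f^0\|_n^2+4\lambda\|(\Delta(k)f)_{-S}\|_1+\Bigl(\sqrt{\frac{k(s+1)}{n}}+\sqrt{\frac{2v}{n}}+\lambda\Gamma_S\Bigr)^2,$$ where $\Gamma_S\ge 0$ is given by $$\Gamma_S^2=n\,C_k\Bigl(\sum_{i\in S^{\pm}}\frac{1+\log n_i}{n_i^{2k-1}}+\sum_{i\in[1:s+1]\setminus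 S^{\pm}}\frac{1+\log n_i}{n_{\max}^{2k-1}}\Bigr).$$
   Context: Notation: $[a:b]=\{j\in\mathbb{N}: a\le j\le b\}$; for $v\in\mathbb{R}^n$, $\|v\|_n^2:=\frac1n\sum_{i=1}^n v_i^2$. For $k\in[1:n-1]$, the $k$-th order difference operator $\Delta(k)\in\mathbb{R}^{(n-k)\times n}$ has rows indexed by $\mathcal{D}=[k+1:n]$ and columns indexed by $[1:n]$, with $\Delta(k)_{ij}=(-1)^l\binom{k}{l}$ if $j=i-l$ with $l\in[0:k]$, $i\in\mathcal{D}$, and $\Delta(k)_{ij}=0$ otherwise. The (trend filtering) estimator is $\hat f:=\arg\min_{g\in\mathbb{R}^n}\{\|Y-g\|_n^2+2\lambda\|\Delta(k)g\|_1\}$. For $S=\{t_1<\cdots<t_s\}\subseteq\mathcal{D}$, put $t_0:=k$, $t_{s+1}:=n+1$, $n_i:=t_i-t_{i-1}$ for $i\in[1:s+1]$, $n_{\max}:=\max_{1\le i\le s+1}n_i$, and $(\Delta(k)f)_{-S}:=\{(\Delta(k)f)_j: j\in\mathcal{D}\setminus S\}$. The sign function takes values in $\{-1,+1\}$, with $\mathrm{sign}(x)\,x=|x|$ (the value at $0$ being an arbitrary choice in $\{-1,+1\}$). *)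

(* Defs.v *)
From HB Require Import structures.
From mathcomp Require Import all_boot all_order all_algebra.
From mathcomp Require Import all_classical all_reals all_analysis.

Set Implicit Arguments.
Unset Strict Implicit.
Unset Printing Implicit Defensive.

Import Order.TTheory GRing.Theory Num.Theory.
Import numFieldNormedType.Exports.

Local Open Scope classical_set_scope.
Local Open Scope ring_scope.

Section Norms.
Context {R : realType} {m : nat}.

(* The square ||v||_m^2, with the normalization by 1/m. *)
Definition sqnormn (v : 'cV[R]_m) : R := m%:R^-1 * \sum_i v i 0 ^+ 2.

Definition norm1 (v : 'cV[R]_m) : R := \sum_i `|v i 0|.

(* The l1-norm of the subvector v_{-S}. *)
Definition norm1_off (S : {set 'I_m}) (v : 'cV[R]_m) : R :=
  \sum_(i | i \notin S) `|v i 0|.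

End Norms.

(* Row r : 'I_(n - k) stands for the index i = k + 1 + r in [k+1 : n], column
   j : 'I_n for the index j + 1 in [1 : n]; so l = i - (j + 1) = k + r - j. *)
Definition diff_op (R : realType) (n k : nat) : 'M[R]_(n - k, n) :=
  \matrix_(r, j) if (r <= j <= k + r)%N
                 then (-1) ^+ (k + r - j) * ('C(k, k + r - j))%:R else 0.

Definition tf_objective (R : realType) (n k : nat) (lambda : R)
    (y g : 'cV[R]_n) : R :=
  sqnormn (y - g) + 2 * lambda * norm1 (diff_op R n k *m g).

Definition is_tf_estimate (R : realType) (n k : nat) (lambda : R)
    (y fh : 'cV[R]_n) : Prop :=
  forall g : 'cV[R]_n,
    tf_objective k lambda y fh <= tf_objective k lambda y g.

Section Probability.
Context {R : realType} {d : measure_display} {T : measurableType d}.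
Variable P : probability T R.

Definition mutually_independent (n : nat) (X : 'I_n -> {RV P >-> R}) : Prop :=
  forall (J : {set 'I_n}) (A : 'I_n -> set R),
    (forall i, measurable (A i)) ->
    P (\bigcap_(i in [set` J]) (X i @^-1` A i)) =
    (\prod_(i in J) P (X i @^-1` A i))%E.

(* Y ~ N_n(mu, I). *)
Definition std_gaussian_vector (n : nat) (mu : 'cV[R]_n)
    (Y : 'I_n -> {RV P >-> R}) : Prop :=
  mutually_independent Y /\
  forall (i : 'I_n) (A : set R), measurable A ->
    distribution P (Y i) A = normal_prob (mu i 0) 1 A.

Definition data_vector (n : nat) (Y : 'I_n -> {RV P >-> R}) (w : T) :
  'cV[R]_n := \col_i Y i w.

End Probability.

(* A sign function whose value at 0 is an arbitrary element of {-1, 1}. *)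
Definition is_sign (R : realType) (sgn : R -> R) : Prop :=
  forall x, (sgn x = 1 \/ sgn x = -1) /\ sgn x * x = `|x|.

Section Knots.
Variables n k : nat.
Variable S : {set 'I_(n - k)}.

(* t_0 = k, t_1 < ... < t_s the elements of S (as indices in [k+1 : n]; enum
   on ordinals is increasing), and t_(s+1) = n + 1 is the default value. *)
Definition knot (i : nat) : nat :=
  nth n.+1 (k :: [seq (k + nat_of_ord r).+1 | r <- enum S]) i.

Definition gap (i : nat) : nat := knot i - knot i.-1.

Definition gap_max : nat := \max_(1 <= i < #|S|.+2) gap i.

Section Signs.
Variables (R : realType) (sgn : R -> R) (f : 'cV[R]_n).

(* q_{t_i}, for i in [1 : s]. *)
Definition knot_sign (i : nat) : R :=
  nth 0 [seq sgn ((diff_op R n k *m f) r 0) | r <- enum S] i.-1.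

(* Membership of i in S^{+-}. *)
Definition sign_change (i : nat) : bool :=
  [|| (2 <= i <= #|S|)%N && (knot_sign i * knot_sign i.-1 == -1),
      i == 1%N | i == #|S|.+1].

Definition Gamma (C : R) : R :=
  Num.sqrt (n%:R * C *
    (\sum_(1 <= i < #|S|.+2 | sign_change i)
        (1 + ln (gap i)%:R) / (gap i)%:R ^+ (2 * k - 1)
     + \sum_(1 <= i < #|S|.+2 | ~~ sign_change i)
        (1 + ln (gap i)%:R) / gap_max%:R ^+ (2 * k - 1))).

End Signs.

Definition lambda0 (R : realType) (u : R) : R :=
  Num.sqrt ((2 * ln (2 * (n - k - #|S|)%:R) + 2 * u) / n%:R).

End Knots.

(* Main.v *)
Require Import Defs.
From HB Require Import structures.
From mathcomp Require Import all_boot all_order all_algebra.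
From mathcomp Require Import all_classical all_reals all_analysis.
From mathcomp Require Import measurable_realfun.
From mathcomp Require Import ring lra zify.

Set Implicit Arguments.
Unset Strict Implicit.
Unset Printing Implicit Defensive.

Import Order.TTheory GRing.Theory Num.Theory.
Import numFieldNormedType.Exports.

Local Open Scope classical_set_scope.
Local Open Scope ring_scope.

(** Let h be the difference of the estimator and of the competitor f. Since the
    estimator minimizes a strongly convex objective, its error is bounded by that
    of f, plus the noise term 2 <eps, h> / n, plus 2 lambda times the difference
    of the two penalties, minus |h|^2 / n (lemma tf_strong_min).

    The noise is split along the kernel N of the rows of the difference operator
    whose window does not straddle a knot. This kernel consists of functions that
    are piecewise polynomial between the knots and has dimension at most k (s + 1)
    (lemma kernel_basis), which makes the projected noise a chi-square variable:
    it yields the term sqrt (k (s + 1) / n) + sqrt (2 v / n) (lemma chi2_tail).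
    Off N, h is a combination of projected Green functions with coefficients
    (D h)_r. A Green function cut off at the knot nearest to r has norm at most
    d_r ^ (k - 1/2), with d_r the distance from r to that knot (lemma green_knots).
    By the Gaussian tail bound and the choice of lambda, the noise seen by (D h)_r
    is thus at most lambda w_r, with w_r a small multiple of
    (d_r / n_max) ^ (k - 1/2).

    It remains to find a vector z that equals the signs of D f at the knots and
    satisfies |z_r| <= 1 - w_r elsewhere, because the penalty then absorbs the
    weighted noise at the price lambda |D^T z| |h| (lemma oracle_inequality). Now
    D^T is again a k-th difference, so z must be smooth although it has to leave
    the value 1 at a knot as fast as d ^ (k - 1/2). The k-th difference of this
    half power is 1 / sqrt d, and the sum of its squares over a gap is the
    logarithm in Gamma. On a gap without a sign change it is enough to dip below 1
    on the scale n_max, whereas a sign change, or the passage to 0 at either end,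
    has to happen on the scale of the gap itself: these are the two sums in Gamma
    (lemmas bump_profile, step_profile and interpolation). The discrete half powers
    are iterated sums of 1 / sqrt x, so that their differences are exact, and the
    profiles are products of two of them, one for each end of the gap.

    Both deviation bounds are Chernoff bounds. The estimator is a 1-Lipschitz
    function of the data (lemma tf_lipschitz), so that the event in the theorem is
    measurable. *)

(** * Changes of measure and independent products *)

Section ChangeOfMeasure.
Context d d' (T : measurableType d) (T' : measurableType d') (R : realType).
Variables (mu : {measure set T -> \bar R}) (nu : {measure set T' -> \bar R}).
Variables (X : T -> T') (W : T -> R).
Hypothesis mX : measurable_fun setT X.
Hypothesis mW : measurable_fun setT W.
Hypothesis W0 : forall w, 0 <= W w.
Hypothesis HW : forall A, measurable A ->
  (\int[mu]_(w in X @^-1` A) (W w)%:E = nu A)%E.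

Import HBNNSimple.
Local Open Scope ereal_scope.

(** The hypothesis HW identifies the two integrals on indicators of measurable
    sets; nonnegative simple functions and monotone convergence extend this to
    every nonnegative f. With X the identity this integrates against a density;
    with W the product of the other factors it isolates one coordinate of an
    independent family. *)
Lemma ge0_integral_density (f : T' -> \bar R) :
  (forall x, 0 <= f x) ->
  measurable_fun [set: T'] f ->
  \int[mu]_w (f (X w) * (W w)%:E) = \int[nu]_x f x.
Proof.
move=> f0 mf; pose h := nnsfun_approx measurableT mf.
have mWE : measurable_fun setT (EFin \o W) by exact/measurable_EFinP.
have mhX n : measurable_fun setT ((EFin \o h n) \o X).
  apply: measurableT_comp => //; exact/measurable_EFinP.
have -> : \int[nu]_x f x = limn (fun n => \int[nu]_x (EFin \o h n) x).
  under eq_integral => x _.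
    rewrite (_ : f x = limn (fun n => (EFin \o h n) x)); last first.
      by apply/esym/cvg_lim => //; exact: cvg_nnsfun_approx.
    over.
  apply: monotone_convergence => //.
  - by move=> n; exact/measurable_EFinP.
  - by move=> n x _; rewrite lee_fin.
  - by move=> x _ a b ab; rewrite lee_fin; exact/lefP/nd_nnsfun_approx.
have -> : \int[mu]_w (f (X w) * (W w)%:E) =
    limn (fun n => \int[mu]_w ((EFin \o h n) (X w) * (W w)%:E)).
  under eq_integral => x _.
    rewrite (_ : f (X x) * _ = limn (fun n => (EFin \o h n) (X x) * (W x)%:E));
      last first.
      apply/esym/cvg_lim => //; apply: cvgeZr => //.
      exact: cvg_nnsfun_approx.
    over.
  apply: monotone_convergence => //.
  - by move=> n; apply: emeasurable_funM => //; exact: mhX.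
  - by move=> n x _ /=; rewrite mule_ge0 ?lee_fin.
  - move=> x _ a b ab /=; rewrite lee_wpmul2r ?lee_fin//.
    exact/lefP/nd_nnsfun_approx.
congr (limn _); apply/funext => n.
have indich r : measurable_fun setT (fun x => (r * \1_(h n @^-1` [set r]) x)%:E).
  by apply/measurable_EFinP; exact: measurable_funM.
have indic1 r : measurable_fun setT (fun x => (\1_(h n @^-1` [set r]) x : R)%:E).
  exact/measurable_EFinP.
transitivity (\int[nu]_x
   (\sum_(y \in range (h n)) (y * \1_(h n @^-1` [set y]) x)%:E)); last first.
  by apply: eq_integral => t _; rewrite /= fimfunE -fsumEFin.
rewrite ge0_integral_fsum//; last by move=> m y Ey; exact: nnfun_muleindic_ge0.
transitivity (\int[mu]_w (\sum_(y \in range (h n))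
    ((y * \1_(h n @^-1` [set y]) (X w))%:E * (W w)%:E))).
  apply: eq_integral => x _.
  rewrite -ge0_mule_fsuml => [|y]; last exact: nnfun_muleindic_ge0.
  by rewrite fsumEFin // -(fimfunE _ (X x)).
rewrite ge0_integral_fsum//; last 2 first.
  - by move=> y; exact: (emeasurable_funM (measurableT_comp (indich y) mX) mWE).
  - by move=> m y Ey; rewrite mule_ge0 ?lee_fin// -lee_fin nnfun_muleindic_ge0.
apply: eq_fsbigr => r rhn.
have r0 : (0 <= r)%R by move: rhn; rewrite inE => -[t _ <-].
under [RHS]eq_integral do rewrite EFinM.
rewrite integralZl_indic_nnsfun => //.
under eq_integral do rewrite EFinM -muleA.
rewrite ge0_integralZl//; last 2 first.
- exact: (emeasurable_funM (measurableT_comp (indic1 r) mX) mWE).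
- by move=> t _; rewrite mule_ge0 ?lee_fin.
congr (_ * _).
rewrite integral_indic// setIT -HW//.
under eq_integral do rewrite muleC.
rewrite [RHS]integral_mkcond.
by apply: eq_integral => x xE; rewrite epatch_indic.
Qed.

End ChangeOfMeasure.

Section IndependentProduct.
Context {R : realType} {d : measure_display} {T : measurableType d}.
Variable P : probability T R.
Variables (n : nat) (Y : 'I_n -> {RV P >-> R}).
Hypothesis indepY : mutually_independent Y.

Let int_indic (A : set T) : measurable A ->
  (\int[P]_w (\1_A w)%:E = P A)%E.
Proof. by move=> mA; rewrite integral_indic// setIT. Qed.

Let mY (i : 'I_n) (A : set R) : measurable A -> measurable (Y i @^-1` A).
Proof. by move=> mA; rewrite -[X in measurable X]setTI; exact: measurable_funPT. Qed.

(** Independence speaks of events only, so the factors are released from being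
    indicators one at a time. When all factors but one are fixed, their product
    is the density of a measure on the events of the remaining coordinate, and
    the induction hypothesis says that this measure is a multiple of the law of
    that coordinate. *)
Lemma ge0_integral_prod_indep (f : 'I_n -> R -> R) (c : 'I_n -> R) :
  (forall i, measurable_fun setT (f i)) ->
  (forall i x, 0 <= f i x) ->
  (forall i, \int[P]_w (f i (Y i w))%:E = (c i)%:E)%E ->
  (\int[P]_w (\prod_i f i (Y i w))%:E = (\prod_i c i)%:E)%E.
Proof.
(* The first m factors are arbitrary, the others are indicators. *)
suff H m : forall (f : 'I_n -> R -> R) (c : 'I_n -> R),
  (forall i, measurable_fun setT (f i)) ->
  (forall i x, 0 <= f i x) ->
  (forall i, \int[P]_w (f i (Y i w))%:E = (c i)%:E)%E ->
  (forall i : 'I_n, (m <= i)%N -> exists2 A, measurable A & f i = \1_A) ->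
  (\int[P]_w (\prod_i f i (Y i w))%:E = (\prod_i c i)%:E)%E.
  by move=> mf f0 fc; apply: (H n) => // i; rewrite leqNgt ltn_ord.
elim: m => [|m IHm] {}f {}c mf f0 fc fA.
  have [A HA] : {A : 'I_n -> set R & forall i, measurable (A i) /\ f i = \1_(A i)}.
    apply: (@choice _ _ (fun i A => measurable A /\ f i = \1_A)) => i.
    by have [//|A] := fA i; exists A.
  have mA i : measurable (A i) by case: (HA i).
  have fE i : f i = \1_(A i) by case: (HA i).
  have cE i : ((c i)%:E = P (Y i @^-1` A i))%E.
    by rewrite -fc fE -int_indic//; apply: mY.
  transitivity (P (\bigcap_(i in [set` [set: 'I_n]%SET]) (Y i @^-1` A i))).
    rewrite -int_indic; last by apply: fin_bigcap_measurable => // i _; apply: mY.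
    apply: eq_integral => w _; congr EFin.
    under eq_bigr do rewrite fE indicE.
    rewrite indicE; have [/mem_set|] := boolP (w \in _).
      rewrite !inE => wA; apply: big1 => i _.
      by rewrite mem_set//; apply: wA; rewrite /= finset.in_setT.
    move=> wA; have [i wi] : exists i, ~ A i (Y i w).
      apply: contrapT => /forallNP H; case/negP: wA; rewrite inE => i _ /=.
      by have /contrapT := H i.
    by apply/eqP; rewrite prodf_seq_eq0; apply/hasP; exists i => //=;
      rewrite ?mem_index_enum// memNset.
  rewrite indepY// -prodEFin.
  by apply: eq_big => [i|i _]; rewrite ?inE// cE.
have [nm|mn] := leqP n m.
  apply: IHm => // i; rewrite leqNgt (leq_trans (ltn_ord i))//.
pose o := Ordinal mn.
pose W w := \prod_(i | i != o) f i (Y i w).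
pose K := \prod_(i | i != o) c i.
have c0 i : 0 <= c i by rewrite -lee_fin -fc integral_ge0// => w _; rewrite lee_fin.
have K0 : 0 <= K by apply: prodr_ge0.
have mW : measurable_fun setT W.
  rewrite (_ : W = fun w => \prod_i (if i != o then f i (Y i w) else 1)).
    apply: measurable_prod => i _; case: (i != o) => //.
    exact: measurableT_comp.
  by apply/funext => w; rewrite /W big_mkcond.
have W0 w : 0 <= W w by apply: prodr_ge0.
pose nu := mscale (NngNum K0) (distribution P (Y o)).
have HW A : measurable A -> (\int[P]_(w in Y o @^-1` A) (W w)%:E = nu A)%E.
  move=> mA; rewrite integral_mkcond.
  have mYA : measurable (Y o @^-1` A) by exact: mY.
  pose f' i := if i == o then \1_A : R -> R else f i.
  pose c' i := if i == o then fine (P (Y o @^-1` A)) else c i.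
  have := IHm f' c'.
  have -> : (\int[P]_w (\prod_i f' i (Y i w))%:E =
     \int[P]_w ((fun w => (W w)%:E) \_ (Y o @^-1` A)) w)%E.
    apply: eq_integral => w _; rewrite (bigD1 o)//= /f' eqxx epatch_indic.
    rewrite EFinM muleC; congr (_%:E * _)%E.
    by apply: eq_bigr => i /negbTE ->.
  rewrite (bigD1 o)//= {2}/c' eqxx (eq_bigr c) => [|i /negbTE io]; last first.
    by rewrite /c' io.
  rewrite -/K => ->; rewrite /nu /mscale/=.
  - by rewrite muleC EFinM fineK// fin_num_measure.
  - by move=> i; rewrite /f'; case: ifP.
  - by move=> i x; rewrite /f'; case: ifP => // _; rewrite indicE.
  - move=> i; rewrite /f' /c'; case: eqP => // ->; rewrite fineK ?fin_num_measure//.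
    by rewrite -int_indic.
  - move=> i mi; rewrite /f'; case: eqP => [_|/eqP io]; first by exists A.
    apply: fA; rewrite ltn_neqAle mi andbT; apply: contra io => /eqP io.
    by apply/eqP/val_inj.
transitivity (\int[P]_w ((f o (Y o w))%:E * (W w)%:E))%E.
  by apply: eq_integral => w _; rewrite (bigD1 o)//= -EFinM.
rewrite (@ge0_integral_density _ _ _ _ _ P nu (Y o) W _ mW W0 HW
  (fun x => (f o x)%:E)); last 3 first.
- exact: measurable_funPT.
- by move=> x; rewrite lee_fin.
- exact/measurable_EFinP.
rewrite /nu ge0_integral_mscale//=; last 2 first.
- exact/measurable_EFinP.
- by move=> x _; rewrite lee_fin.
rewrite ge0_integral_distribution//=; last 2 first.
- exact/measurable_EFinP.
- by move=> x; rewrite lee_fin.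
by rewrite fc -EFinM (bigD1 o)//= mulrC.
Qed.

End IndependentProduct.

(** * Gaussian integrals and deviation of the noise *)

Section NormalIntegrals.
Context {R : realType}.
Local Notation leb := (@lebesgue_measure R).

Lemma ge0_integral_normal (m s : R) (f : R -> \bar R) :
  (forall x, 0 <= f x)%E -> measurable_fun setT f ->
  (\int[normal_prob m s]_x f x =
   \int[leb]_x (f x * (normal_pdf m s x)%:E))%E.
Proof.
move=> f0 mf; apply/esym.
apply: (@ge0_integral_density _ _ _ _ _ leb (normal_prob m s) id) => //.
- exact: measurable_normal_pdf.
- exact: normal_pdf_ge0.
Qed.

(** Completing the square: the integrand is a multiple of the normal density
    centred at m + a. *)
Lemma normal_mgf (m a : R) :
  (\int[normal_prob m 1]_x (expR (a * (x - m)))%:E = (expR (a ^+ 2 / 2))%:E)%E.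
Proof.
rewrite ge0_integral_normal//; last 1 first.
- apply/measurable_EFinP; apply: measurableT_comp => //.
  by apply: measurable_funM => //; exact: measurable_funB.
have E x : expR (a * (x - m)) * normal_pdf m 1 x =
    expR (a ^+ 2 / 2) * normal_pdf (m + a) 1 x.
  rewrite !normal_pdfE ?oner_eq0// mulrCA [RHS]mulrCA; congr (_ * _).
  by rewrite /normal_fun -!expRD; congr expR; rewrite -mulr_natr; field.
under eq_integral do rewrite -EFinM E EFinM.
rewrite ge0_integralZl ?lee_fin ?expR_ge0//.
- by rewrite integral_normal_pdf mule1.
- by apply/measurable_EFinP; exact: measurable_normal_pdf.
- by move=> x _; rewrite lee_fin normal_pdf_ge0.
Qed.

(** The integrand is a multiple of the centred normal density of variance
    1 / (1 - s). *)
Lemma normal_mgf_sq (s : R) : 0 <= s < 1 ->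
  (\int[normal_prob 0 1]_x (expR (s / 2 * x ^+ 2))%:E =
   ((Num.sqrt (1 - s))^-1)%:E)%E.
Proof.
move=> /andP[s0 s1].
rewrite ge0_integral_normal//; last 1 first.
- apply/measurable_EFinP; apply: measurableT_comp => //.
  by apply: measurable_funM => //; exact: measurable_funX.
have s1' : 0 < 1 - s by rewrite subr_gt0.
set sg := (Num.sqrt (1 - s))^-1.
have sq0 : Num.sqrt (1 - s) != 0 by rewrite gt_eqF// sqrtr_gt0.
have sg0 : sg != 0 by rewrite invr_eq0.
have sg2 : sg ^+ 2 = (1 - s)^-1 by rewrite exprVn sqr_sqrtr// ltW.
have E x : expR (s / 2 * x ^+ 2) * normal_pdf 0 1 x = sg * normal_pdf 0 sg x.
  rewrite !normal_pdfE ?oner_eq0// mulrCA [RHS]mulrA; congr (_ * _).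
    rewrite /normal_peak sg2 expr1n mul1r -mulrnAr sqrtrM ?invr_ge0 ?ltW//.
    by rewrite sqrtrV ?ltW// invfM invrK mulrA mulVf// mul1r.
  rewrite /normal_fun sg2 -!expRD; congr expR.
  by rewrite !mulr2n expr1n subr0; field; rewrite gt_eqF.
under eq_integral do rewrite -EFinM E EFinM.
rewrite ge0_integralZl ?lee_fin ?invr_ge0//.
- by rewrite integral_normal_pdf mule1.
- by apply/measurable_EFinP; exact: measurable_normal_pdf.
- by move=> x _; rewrite lee_fin normal_pdf_ge0.
Qed.

End NormalIntegrals.

Definition dotv {R : realType} {n : nat} (x y : 'cV[R]_n) : R :=
  \sum_i x i 0 * y i 0.

Section DotProduct.
Context {R : realType} {n : nat}.
Implicit Types x y z : 'cV[R]_n.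

Lemma dotvC x y : dotv x y = dotv y x.
Proof. by apply: eq_bigr => i _; rewrite mulrC. Qed.

Lemma dotvDl x y z : dotv (x + y) z = dotv x z + dotv y z.
Proof. by rewrite -big_split; apply: eq_bigr => i _; rewrite mxE mulrDl. Qed.

Lemma dotvDr x y z : dotv z (x + y) = dotv z x + dotv z y.
Proof. by rewrite dotvC dotvDl !(dotvC z). Qed.

Lemma dotvZl a x y : dotv (a *: x) y = a * dotv x y.
Proof. by rewrite /dotv mulr_sumr; apply: eq_bigr => i _; rewrite mxE mulrA. Qed.

Lemma dotvZr a x y : dotv x (a *: y) = a * dotv x y.
Proof. by rewrite dotvC dotvZl dotvC. Qed.

Lemma dotvNl x y : dotv (- x) y = - dotv x y.
Proof. by rewrite -scaleN1r dotvZl mulN1r. Qed.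

Lemma dotvBl x y z : dotv (x - y) z = dotv x z - dotv y z.
Proof. by rewrite dotvDl dotvNl. Qed.

Lemma dotvBr x y z : dotv z (x - y) = dotv z x - dotv z y.
Proof. by rewrite dotvC dotvBl !(dotvC z). Qed.

Lemma dotv0l x : dotv 0 x = 0.
Proof. by rewrite /dotv big1// => i _; rewrite mxE mul0r. Qed.

Lemma dotv0r x : dotv x 0 = 0.
Proof. by rewrite dotvC dotv0l. Qed.

Lemma dotv_suml (I : Type) (s : seq I) (P : pred I) (F : I -> 'cV[R]_n) x :
  dotv (\sum_(i <- s | P i) F i) x = \sum_(i <- s | P i) dotv (F i) x.
Proof.
by elim/big_rec2: _ => [|i a b _ <-]; rewrite ?dotv0l// dotvDl.
Qed.

Lemma dotv_sumr (I : Type) (s : seq I) (P : pred I) (F : I -> 'cV[R]_n) x :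
  dotv x (\sum_(i <- s | P i) F i) = \sum_(i <- s | P i) dotv x (F i).
Proof. by rewrite dotvC dotv_suml; apply: eq_bigr => i _; rewrite dotvC. Qed.

Lemma dotv_ge0 x : 0 <= dotv x x.
Proof. by apply: sumr_ge0 => i _; rewrite -expr2 sqr_ge0. Qed.

Lemma dotv_eq0 x : dotv x x = 0 -> x = 0.
Proof.
move=> /eqP; rewrite psumr_eq0 => [/allP x0|i _]; last by rewrite -expr2 sqr_ge0.
apply/colP => i; rewrite mxE; apply/eqP.
by have := x0 i (mem_index_enum _); rewrite mulf_eq0 orbb.
Qed.

Definition norm2 x := Num.sqrt (dotv x x).

Lemma norm2_ge0 x : 0 <= norm2 x.
Proof. exact: sqrtr_ge0. Qed.

Lemma norm2_sqr x : norm2 x ^+ 2 = dotv x x.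
Proof. by rewrite sqr_sqrtr// dotv_ge0. Qed.

(** Expand 0 <= |b x - a y|^2 with a and b the norms of x and y. *)
Lemma cauchy_schwarz x y : dotv x y <= norm2 x * norm2 y.
Proof.
have [x0|x0] := eqVneq (norm2 x) 0.
  have -> : x = 0 by apply: dotv_eq0; rewrite -norm2_sqr x0 expr0n.
  by rewrite dotv0l mulr_ge0// norm2_ge0.
have [y0|y0] := eqVneq (norm2 y) 0.
  have -> : y = 0 by apply: dotv_eq0; rewrite -norm2_sqr y0 expr0n.
  by rewrite dotv0r mulr_ge0// norm2_ge0.
have p0 : 0 < 2 * (norm2 x * norm2 y).
  by rewrite mulr_gt0// mulr_gt0// lt0r ?x0 ?y0 norm2_ge0.
rewrite -subr_ge0 -(pmulr_rge0 _ p0).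
suff -> : 2 * (norm2 x * norm2 y) * (norm2 x * norm2 y - dotv x y) =
  dotv (norm2 y *: x - norm2 x *: y) (norm2 y *: x - norm2 x *: y).
  exact: dotv_ge0.
rewrite dotvBl !dotvBr !dotvZl !dotvZr (dotvC y x) -!norm2_sqr; ring.
Qed.

End DotProduct.

Definition orthonormal_seq {R : realType} {n : nat} (us : seq 'cV[R]_n) : Prop :=
  forall i j, (i < size us)%N -> (j < size us)%N ->
    dotv us`_i us`_j = (i == j)%:R.

Section GaussianVector.
Context {R : realType} {d : measure_display} {T : measurableType d}.
Variable P : probability T R.
Variables (n : nat) (mu : 'cV[R]_n) (Y : 'I_n -> {RV P >-> R}).
Hypothesis hY : std_gaussian_vector mu Y.

Local Notation eps w := (data_vector Y w - mu).

Lemma measurable_noise (a : 'cV[R]_n) :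
  measurable_fun setT (fun w => dotv a (eps w)).
Proof.
apply: measurable_sum => i; apply: measurable_funM => //.
rewrite (_ : (fun w => _) = (fun w => Y i w - mu i 0)).
  by apply: measurable_funB => //; exact: measurable_funPT.
by apply/funext => w; rewrite !mxE.
Qed.

Lemma noise_mgf (a : 'cV[R]_n) :
  (\int[P]_w (expR (dotv a (eps w)))%:E = (expR (dotv a a / 2))%:E)%E.
Proof.
transitivity (\int[P]_w (\prod_i expR (a i 0 * (Y i w - mu i 0)))%:E)%E.
  apply: eq_integral => w _; congr EFin; rewrite -expR_sum; congr expR.
  by apply: eq_bigr => i _; rewrite !mxE.
rewrite (ge0_integral_prod_indep (proj1 hY)
  (f := fun i x => expR (a i 0 * (x - mu i 0)))
  (c := fun i => expR (a i 0 ^+ 2 / 2))).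
- rewrite -expR_sum; congr (expR _)%:E.
  by rewrite /dotv mulr_suml; apply: eq_bigr => i _; rewrite expr2.
- move=> i; apply: measurableT_comp => //.
  by apply: measurable_funM => //; exact: measurable_funB.
- by move=> i x; exact: expR_ge0.
- move=> i; rewrite -(normal_mgf (mu i 0)).
  rewrite -(@ge0_integral_density _ _ _ _ _ P (normal_prob (mu i 0) 1) (Y i)
    (fun=> 1)) => //.
  + by apply: eq_integral => w _; rewrite mule1.
  + exact: (measurable_funPT (Y i)).
  + move=> A mA; rewrite integral_cst ?mul1e; first exact: (proj2 hY i A mA).
    by rewrite -[X in measurable X]setTI; exact: (measurable_funPT (Y i)).
  + apply/measurable_EFinP; apply: measurableT_comp => //.
    by apply: measurable_funM => //; exact: measurable_funB.
Qed.

(** The exponential of s t^2 / 2 is the average of exp (sqrt s g t) over a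
    standard normal g. Applied to t = <u, noise> for the first vector u, this
    turns a square into the linear term b + sqrt s g u, which is still orthogonal
    to the other vectors. After exchanging the two integrals, the induction
    hypothesis leaves a one-dimensional Gaussian integral in g. *)
Lemma noise_mgf_sumsq (s : R) (us : seq 'cV[R]_n) (b : 'cV[R]_n) :
  0 <= s < 1 -> orthonormal_seq us -> (forall u, u \in us -> dotv b u = 0) ->
  (\int[P]_w (expR (dotv b (eps w)
      + s / 2 * \sum_(u <- us) dotv u (eps w) ^+ 2))%:E =
   ((Num.sqrt (1 - s))^-1 ^+ size us * expR (dotv b b / 2))%:E)%E.
Proof.
move=> s01; elim: us b => [|u us IHus] b on bus.
  transitivity (\int[P]_w (expR (dotv b (eps w)))%:E)%E.
    by apply: eq_integral => w _; rewrite big_nil mulr0 addr0.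
  by rewrite noise_mgf /= expr0 [in RHS]mul1r.
have /andP[s0 s1] := s01.
have onus : orthonormal_seq us by move=> i j hi hj; have := on i.+1 j.+1 hi hj.
have uu : dotv u u = 1 by have := on 0%N 0%N isT isT.
have uus v : v \in us -> dotv u v = 0.
  move=> vus; have := on 0%N (index v us).+1 isT; rewrite /= nth_index//; apply.
  by rewrite ltnS index_mem.
have bu : dotv b u = 0 by rewrite bus// mem_head.
pose F (z : T * R) := expR (dotv b (eps z.1)
  + (Num.sqrt s * z.2) * dotv u (eps z.1)
  + s / 2 * \sum_(v <- us) dotv v (eps z.1) ^+ 2).
have F0 z : (0 <= (F z)%:E)%E by rewrite lee_fin expR_ge0.
have mn1 (a : 'cV[R]_n) :
    measurable_fun setT (fun z : T * R => dotv a (eps z.1)).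
  by apply: (measurableT_comp (measurable_noise a)).
have mF : measurable_fun setT (EFin \o F).
  apply/measurable_EFinP; apply: measurableT_comp => //.
  apply: measurable_funD; first apply: measurable_funD => //.
    by apply: measurable_funM => //; apply: measurable_funM.
  apply: measurable_funM => //; apply: measurable_sum => v.
  exact: measurable_funX.
transitivity (\int[P]_w \int[normal_prob 0 1]_g (EFin \o F) (w, g))%E.
  apply: eq_integral => w _; rewrite /F /=.
  pose K := expR (dotv b (eps w) + s / 2 * \sum_(v <- us) dotv v (eps w) ^+ 2).
  under eq_integral => g _.
    rewrite (_ : expR _ = K * expR (Num.sqrt s * dotv u (eps w) * (g - 0))); last first.
      by rewrite -expRD; congr expR; ring.
    rewrite EFinM; over.
  rewrite ge0_integralZl ?lee_fin ?expR_ge0//; last first.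
    apply/measurable_EFinP; apply: measurableT_comp => //.
    by apply: measurable_funM => //; exact: measurable_funB.
  rewrite normal_mgf -EFinM -expRD big_cons exprMn sqr_sqrtr//.
  by congr (expR _)%:E; ring.
rewrite (@fubini_tonelli _ _ _ _ _ P (normal_prob 0 1) (EFin \o F))//.
have E g : (\int[P]_w (EFin \o F) (w, g) =
    ((Num.sqrt (1 - s))^-1 ^+ size us * expR (dotv b b / 2))%:E
      * (expR (s / 2 * g ^+ 2))%:E)%E.
  have := IHus (b + (Num.sqrt s * g) *: u) onus.
  rewrite (_ : dotv (b + _) _ = dotv b b + s * g ^+ 2); last first.
    rewrite !(dotvDl, dotvDr, dotvZl, dotvZr) uu bu (dotvC u) bu.
    by rewrite -[s in RHS]sqr_sqrtr//; ring.
  rewrite mulrDl expRD mulrA EFinM mulrAC => <-.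
    by apply: eq_integral => w _; rewrite /F/= dotvDl dotvZl.
  move=> v vus; rewrite dotvDl dotvZl uus// mulr0 addr0 bus//.
  by rewrite inE vus orbT.
under eq_integral do rewrite E.
rewrite ge0_integralZl ?lee_fin ?mulr_ge0 ?exprn_ge0 ?invr_ge0 ?expR_ge0//.
  by rewrite normal_mgf_sq// -EFinM /= exprS; congr EFin; ring.
apply/measurable_EFinP; apply: measurableT_comp => //.
by apply: measurable_funM => //; exact: measurable_funX.
Qed.

Lemma le_prob_integral_exp (g : T -> R) : measurable_fun setT g ->
  (P [set w | (0 <= g w)%R] <= \int[P]_w (expR (g w))%:E)%E.
Proof.
move=> mg.
set A := [set w | _].
have mA : measurable A.
  rewrite (_ : A = g @^-1` `[0, +oo[); last first.
    by apply/seteqP; split => w /=; rewrite in_itv/= andbT.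
  by rewrite -[X in measurable X]setTI; exact: mg.
have -> : (P A = \int[P]_x (\1_A x)%:E)%E by rewrite integral_indic// setIT.
 apply: ge0_le_integral => //.
- by apply/measurable_EFinP.
- by apply/measurable_EFinP; apply: measurableT_comp.
move=> w _; rewrite lee_fin indicE; have [|_] := boolP (w \in _).
  by rewrite inE/= => gw; rewrite -[leLHS]expR0 ler_expR.
exact: expR_ge0.
Qed.

(** Chernoff bound with parameter t / sigma. *)
Lemma noise_tail (a : 'cV[R]_n) (sigma t : R) :
  norm2 a <= sigma -> 0 < sigma -> 0 < t ->
  (P [set w | (t * sigma <= dotv a (eps w))%R] <= (expR (- (t ^+ 2 / 2)))%:E)%E.
Proof.
move=> asg sg0 t0.
rewrite (_ : [set w | _] =
  [set w | 0 <= dotv ((t / sigma) *: a) (eps w) - t ^+ 2]); last first.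
  apply/seteqP; split => w /=; rewrite subr_ge0 dotvZl mulrAC ler_pdivlMr//.
    by rewrite expr2 -mulrA ler_pM2l.
  by rewrite expr2 -mulrA ler_pM2l.
apply: le_trans (le_prob_integral_exp _) _.
  by apply: measurable_funB => //; exact: measurable_noise.
under eq_integral do rewrite expRD mulrC EFinM.
rewrite ge0_integralZl ?lee_fin ?expR_ge0//; last first.
  apply/measurable_EFinP; apply: measurableT_comp => //; exact: measurable_noise.
rewrite noise_mgf -EFinM -expRD lee_fin ler_expR dotvZl dotvZr -norm2_sqr.
have : t / sigma * norm2 a <= t.
  by rewrite mulrAC ler_pdivrMr// ler_pM2l.
have : 0 <= t / sigma * norm2 a by rewrite mulr_ge0 ?norm2_ge0// divr_ge0// ltW.
set z := t / sigma * norm2 a => z0 zt.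
have -> : t / sigma * (t / sigma * norm2 a ^+ 2) = z ^+ 2 by rewrite /z; ring.
have : z ^+ 2 <= t ^+ 2 by rewrite ler_sqr ?nnegrE// ltW.
lra.
Qed.

Lemma noise_tail_abs (a : 'cV[R]_n) (sigma t : R) :
  norm2 a <= sigma -> 0 < sigma -> 0 < t ->
  (P [set w | (t * sigma <= `|dotv a (eps w)|)%R] <=
     (2 * expR (- (t ^+ 2 / 2)))%:E)%E.
Proof.
move=> asg sg0 t0.
have mS (c : 'cV[R]_n) : measurable [set w | t * sigma <= dotv c (eps w)].
  rewrite (_ : [set _ | _] = (fun w => dotv c (eps w)) @^-1` `[t * sigma, +oo[).
    by rewrite -[X in measurable X]setTI; exact: measurable_noise.
  by apply/seteqP; split => w /=; rewrite in_itv/= andbT.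
rewrite (_ : [set w | _] = [set w | t * sigma <= dotv a (eps w)] `|`
    [set w | t * sigma <= dotv (- a) (eps w)]); last first.
  by apply/seteqP; split => w /=; rewrite dotvNl ler_normr => /orP.
apply: le_trans (measureU2 _ _ _) _ => //.
rewrite mulrDl mul1r EFinD; apply: leeD; apply: noise_tail => //.
by rewrite /norm2 dotvNl dotvC dotvNl opprK.
Qed.

(** Chernoff bound for a chi-square variable with r <= K degrees of freedom:
    with x = (sqrt r + c)^2 the threshold and c = sqrt (2 v), the parameter
    s = 1 - r / x is optimal, and 1 + y <= exp y at y = c / sqrt r gives the
    exponent - v. *)
Lemma chi2_tail (us : seq 'cV[R]_n) (K : nat) (v : R) :
  orthonormal_seq us -> (size us <= K)%N -> 0 < v ->
  (P [set w | ((Num.sqrt K%:R + Num.sqrt (2 * v)) ^+ 2 <=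
       \sum_(u <- us) dotv u (eps w) ^+ 2)%R] <= (expR (- v))%:E)%E.
Proof.
move=> on usK v0.
set r := size us in usK *; set c := Num.sqrt (2 * v).
have c0 : 0 < c by rewrite sqrtr_gt0 mulr_gt0.
have c2 : c ^+ 2 = 2 * v by rewrite sqr_sqrtr// mulr_ge0// ltW.
have mS : measurable_fun setT (fun w => \sum_(u <- us) dotv u (eps w) ^+ 2).
  by apply: measurable_sum => u; apply: measurable_funX; exact: measurable_noise.
have mSge x : measurable [set w | x <= \sum_(u <- us) dotv u (eps w) ^+ 2].
  rewrite (_ : [set _ | _] =
    (fun w => \sum_(u <- us) dotv u (eps w) ^+ 2) @^-1` `[x, +oo[).
    by rewrite -[X in measurable X]setTI; exact: mS.
  by apply/seteqP; split => w /=; rewrite in_itv/= andbT.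
have [r0|r0] := posnP r.
  rewrite (_ : [set w | _] = set0) ?measure0 ?lee_fin ?expR_ge0//.
  apply/seteqP; split => w //=; rewrite (size0nil r0) big_nil leNgt => /negP; apply.
  by rewrite exprn_gt0// ltr_wpDl// sqrtr_ge0.
set q := Num.sqrt (r%:R : R).
have q0 : 0 < q by rewrite sqrtr_gt0 ltr0n.
have q2 : q ^+ 2 = r%:R by rewrite sqr_sqrtr.
set x := (q + c) ^+ 2.
have qc0 : 0 < q + c by rewrite addr_gt0.
have x0 : 0 < x by rewrite exprn_gt0.
apply: (@le_trans _ _ (P [set w | x <= \sum_(u <- us) dotv u (eps w) ^+ 2])).
  apply: le_measure; [exact/mem_set/mSge|exact/mem_set/mSge|].
  move=> w /=; apply: le_trans.
  rewrite ler_sqr ?nnegrE ?addr_ge0 ?sqrtr_ge0// lerD2r.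
  by apply: ler_wsqrtr; rewrite ler_nat.
pose s := 1 - r%:R / x.
have s1E : 1 - s = (q / (q + c)) ^+ 2.
  by rewrite /s opprB addrC subrK expr_div_n q2.
have s0 : 0 < s.
  rewrite /s subr_gt0 ltr_pdivrMr// mul1r -q2 ltr_sqr ?nnegrE ?ltW//.
  by rewrite ltrDl.
have s01 : 0 <= s < 1.
  by rewrite ltW//= -subr_gt0 s1E exprn_gt0// divr_gt0.
rewrite (_ : [set w | _] =
  [set w | 0 <= s / 2 * (\sum_(u <- us) dotv u (eps w) ^+ 2 - x)]); last first.
  apply/seteqP; split => w /=; rewrite pmulr_rge0 ?divr_gt0// subr_ge0//.
apply: le_trans (le_prob_integral_exp _) _.
  by apply: measurable_funM => //; exact: measurable_funB.
under eq_integral => w _.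
  rewrite (_ : expR _ = expR (- (s / 2 * x)) *
      expR (dotv 0 (eps w) + s / 2 * \sum_(u <- us) dotv u (eps w) ^+ 2)).
    by rewrite EFinM; over.
  by rewrite -expRD dotv0l; congr expR; ring.
rewrite ge0_integralZl ?lee_fin ?expR_ge0//; last first.
  apply/measurable_EFinP; apply: measurableT_comp => //.
  apply: measurable_funD; first exact: measurable_noise.
  exact: measurable_funM.
rewrite noise_mgf_sumsq//; last by move=> u _; rewrite dotv0l.
have qqc : 0 <= q / (q + c) by rewrite divr_ge0// ltW.
rewrite dotv0l mul0r expR0 mulr1 -EFinM lee_fin s1E sqrtr_sqr ger0_norm//.
rewrite invf_div -/r.
have : ((q + c) / q) ^+ r <= expR (q * c).
  have -> : expR (q * c) = expR (c / q) ^+ r.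
    rewrite -expRM_natl; congr expR.
    by rewrite -q2; field; rewrite gt_eqF.
  have qcq : 0 <= (q + c) / q by rewrite divr_ge0// ltW.
  rewrite lerXn2r ?nnegrE ?expR_ge0//.
  by rewrite mulrDl divff ?gt_eqF//; exact: expR_ge1Dx.
move=> /(ler_wpM2l (expR_ge0 (- (s / 2 * x)))) /le_trans; apply.
rewrite -expRD ler_expR.
have -> : s / 2 * x = (x - q ^+ 2) / 2.
  by rewrite /s q2; field; rewrite gt_eqF.
by rewrite /x; move: c2; nra.
Qed.

End GaussianVector.

(** * Differences of discrete half powers *)

Section DifferenceCalculus.
Context {R : realType}.
Implicit Types (f g a : nat -> R) (m n x y : nat).

(** The predecessor of 0 is 0, so that f behaves as if it were extended to the
    negative integers by the constant f 0. *)
Definition bdiff f x : R := f x - f x.-1.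

(** Iterated summation, a right inverse of the iterated difference on functions
    that vanish at 0. *)
Fixpoint isum m a : nat -> R :=
  if m is m'.+1 then fun x => \sum_(1 <= y < x.+1) isum m' a y else a.

Lemma isum0 m a : a 0%N = 0 -> isum m a 0%N = 0.
Proof. by case: m => //= m _; rewrite big_geq. Qed.

Lemma isumS m a x : isum m.+1 a x.+1 = isum m.+1 a x + isum m a x.+1.
Proof. by rewrite /= big_nat_recr. Qed.

Lemma bdiff_isum m a x : a 0%N = 0 -> bdiff (isum m.+1 a) x = isum m a x.
Proof.
case: x => [|x] a0; rewrite /bdiff; first by rewrite subrr isum0.
by rewrite isumS addrC addKr.
Qed.

Lemma eq_bdiff f g : f =1 g -> bdiff f =1 bdiff g.
Proof. by move=> fg x; rewrite /bdiff !fg. Qed.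

Lemma eq_iter_bdiff k f g : f =1 g -> iter k bdiff f =1 iter k bdiff g.
Proof. by move=> fg; elim: k => //= k IHk; exact: eq_bdiff. Qed.

Lemma iter_bdiffD k f g x :
  iter k bdiff (fun y => f y + g y) x = iter k bdiff f x + iter k bdiff g x.
Proof. by elim: k x => //= k IHk x; rewrite /bdiff !IHk; ring. Qed.

Lemma iter_bdiffZ k c f x : iter k bdiff (fun y => c * f y) x = c * iter k bdiff f x.
Proof. by elim: k x => //= k IHk x; rewrite /bdiff !IHk; ring. Qed.

Lemma iter_bdiff_sum k (I : Type) (s : seq I) (F : I -> nat -> R) x :
  iter k bdiff (fun y => \sum_(i <- s) F i y) x = \sum_(i <- s) iter k bdiff (F i) x.
Proof.
elim: k x => //= k IHk x; rewrite /bdiff !IHk -sumrB.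
by apply: eq_bigr.
Qed.

Lemma iter_bdiff_shift k t f x :
  iter k bdiff (fun y => f (y - t)%N) x = iter k bdiff f (x - t)%N.
Proof.
elim: k x => //= k IHk x; rewrite /bdiff !IHk.
by have -> : (x.-1 - t = (x - t).-1)%N by lia.
Qed.

Lemma iter_bdiffE k f x :
  iter k bdiff f x = \sum_(l < k.+1) (-1) ^+ l * 'C(k, l)%:R * f (x - l)%N.
Proof.
elim: k x => [|k IHk] x.
  by rewrite big_ord_recl big_ord0 /= bin0 expr0 !mul1r subn0 addr0.
rewrite iterS /bdiff !IHk.
rewrite [RHS]big_ord_recl /= bin0 subn0.
have -> : \sum_(l < k.+1) (-1) ^+ l * 'C(k, l)%:R * f (x - l)%N =
   f x + \sum_(l < k.+1) (-1) ^+ l.+1 * 'C(k, l.+1)%:R * f (x - l.+1)%N.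
  rewrite big_ord_recl /= bin0 subn0 expr0 !mul1r; congr (_ + _).
  rewrite [RHS]big_ord_recr /= bin_small// mulr0 mul0r addr0.
  by apply: eq_bigr => l _.
rewrite expr0 !mul1r -addrA; congr (_ + _); rewrite -sumrB.
apply: eq_bigr => l _; rewrite /bump /= add1n binS natrD exprS.
by rewrite -subn1 -subnDA add1n; ring.
Qed.

Lemma eq_iter_bdiff_in k f g x :
  (forall y, (x - k <= y <= x)%N -> f y = g y) ->
  iter k bdiff f x = iter k bdiff g x.
Proof.
move=> fg; rewrite !iter_bdiffE; apply: eq_bigr => l _; rewrite fg//.
by have := ltn_ord l; lia.
Qed.

Lemma iter_bdiff_rev k (u v : nat) f :
  iter k bdiff (fun y => f (u - y)%N) (v + k)%N =
    (-1) ^+ k * iter k bdiff f (u - v)%N.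
Proof.
rewrite !iter_bdiffE mulr_sumr (reindex_inj rev_ord_inj) /=.
apply: eq_bigr => -[l lk] _ /=; rewrite subSS.
have {}lk : (l <= k)%N by rewrite -ltnS.
rewrite bin_sub// -signr_odd oddB// signr_addb !signr_odd.
rewrite (_ : (u - (v + k - (k - l)) = u - v - l)%N); last by lia.
by ring.
Qed.

End DifferenceCalculus.

Section PowerProfile.
Context {R : realType}.
Implicit Types (m n x y a b M : nat).

Definition rsqrt x : R := (Num.sqrt x%:R)^-1.

(** The discrete counterpart of a multiple of x ^ (m - 1/2), tuned so that its
    m-th difference is exactly 1 / sqrt x: the squares of these differences have
    a harmonic, hence logarithmic, sum. *)
Definition hpow m : nat -> R := isum m rsqrt.

Lemma rsqrt0 : rsqrt 0 = 0.
Proof. by rewrite /rsqrt sqrtr0 invr0. Qed.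

Lemma rsqrt_ge0 x : 0 <= rsqrt x.
Proof. by rewrite invr_ge0 sqrtr_ge0. Qed.

Lemma rsqrt_sqr x : rsqrt x ^+ 2 = x%:R^-1.
Proof. by rewrite exprVn sqr_sqrtr. Qed.

Lemma hpow0 m : hpow m 0 = 0.
Proof. exact/isum0/rsqrt0. Qed.

Lemma hpow_ge0 m x : 0 <= hpow m x.
Proof.
elim: m x => [|m IHm] x; first exact: rsqrt_ge0.
by apply: sumr_ge0 => y _; exact: IHm.
Qed.

Lemma bdiff_hpow m x : bdiff (hpow m.+1) x = hpow m x.
Proof. exact/bdiff_isum/rsqrt0. Qed.

(** By telescoping, since sqrt (x + 1) - sqrt x >= 1 / (2 sqrt (x + 1)). *)
Lemma hpow1_le x : hpow 1 x <= 2 * Num.sqrt x%:R.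
Proof.
elim: x => [|x IHx]; first by rewrite hpow0 mulr_ge0// sqrtr_ge0.
rewrite /hpow isumS -/(hpow 1 x) /= /rsqrt.
set u := Num.sqrt x%:R in IHx *; set v := Num.sqrt x.+1%:R.
have v0 : 0 < v by rewrite sqrtr_gt0 ltr0n.
have u0 : 0 <= u by exact: sqrtr_ge0.
have E : v ^+ 2 = u ^+ 2 + 1 by rewrite !sqr_sqrtr// -natr1.
have uv : u <= v by rewrite ler_wsqrtr// ler_nat.
have : v^-1 <= 2 * (v - u).
  rewrite -(ler_pM2r v0) mulVf ?gt_eqF//.
  nra.
lra.
Qed.

Lemma hpow_ub m x : hpow m x <= 2 * x%:R ^+ m * rsqrt x.
Proof.
elim: m x => [|[|m] IHm] x.
- by rewrite expr0 mulr1 /hpow /=; have := rsqrt_ge0 x; lra.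
- case: x => [|x]; first by rewrite hpow0 mulr0 mul0r.
  apply: le_trans (hpow1_le _) _; rewrite expr1 /rsqrt -mulrA ler_pM2l//.
  rewrite -{2}[x.+1%:R]sqr_sqrtr// expr2 mulfK// gt_eqF// sqrtr_gt0 ltr0n//.
- case: x => [|x]; first by rewrite hpow0 expr0n /= mulr0 mul0r.
  rewrite {1}/hpow /= -/(hpow m.+1).
  have rx0 := rsqrt_ge0 x.+1.
  apply: (@le_trans _ _ (\sum_(1 <= y < x.+2) 2 * x.+1%:R ^+ m.+1 * rsqrt x.+1)).
    rewrite !big_nat; apply: ler_sum => y /andP[y0 yx].
    apply: le_trans (IHm y) _; rewrite -!mulrA ler_pM2l// !exprSr -!mulrA.
    have yE z : (0 < z)%N -> z%:R * rsqrt z = Num.sqrt z%:R.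
      move=> z0; rewrite /rsqrt -{1}[z%:R]sqr_sqrtr// expr2 mulfK//.
      by rewrite gt_eqF// sqrtr_gt0 ltr0n.
    rewrite !yE//; apply: ler_pM; rewrite ?exprn_ge0 ?sqrtr_ge0//.
      by rewrite lerXn2r ?nnegrE// ler_nat.
    by rewrite ler_wsqrtr// ler_nat.
  rewrite sumr_const_nat subn1 /= -mulr_natr.
  rewrite [_ ^+ m.+2]exprSr; move: (_ ^+ m.+1) => e.
  by rewrite le_eqVlt; apply/orP; left; apply/eqP; ring.
Qed.

Lemma pow_diff_le m x : x.+1%:R ^+ m.+1 <= x%:R ^+ m.+1 + m.+1%:R * x.+1%:R ^+ m :> R.
Proof.
elim: m => [|m IHm]; first by rewrite !expr1 expr0 mulr1 natr1.
rewrite exprS [x%:R ^+ m.+2]exprS.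
have h : 0 <= (x%:R : R) by [].
have h2 : (x%:R : R) ^+ m.+1 <= x.+1%:R ^+ m.+1.
  by rewrite lerXn2r ?nnegrE// ler_nat.
rewrite -[x.+1%:R]natr1 mulrDl mul1r natr1.
apply: (@le_trans _ _ (x%:R * (x%:R ^+ m.+1 + m.+1%:R * x.+1%:R ^+ m) + x.+1%:R ^+ m.+1)).
  by rewrite lerD2r ler_wpM2l.
rewrite mulrDr -addrA lerD2l -[m.+2%:R]natr1 mulrDl mul1r lerD2r mulrCA.
rewrite ler_wpM2l// exprS ler_wpM2r ?exprn_ge0// ler_nat//.
Qed.

(** Replacing every 1 / sqrt by the smallest one, 1 / sqrt y, reduces the claim to
    the iterated sums of a constant, which exceed x^m / m!. *)
Lemma hpow_lb m x y : (0 < x <= y)%N -> x%:R ^+ m * rsqrt y <= m`!%:R * hpow m x.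
Proof.
move=> /andP[x0 xy]; have y0 := leq_trans x0 xy.
elim: m x x0 xy => [|m IHm] x x0 xy.
  rewrite expr0 fact0 !mul1r /rsqrt lef_pV2 ?posrE ?sqrtr_gt0 ?ltr0n//.
  by rewrite ler_wsqrtr// ler_nat.
rewrite factS natrM -mulrA.
elim: x x0 xy => // x IHx _ xy; case: x IHx xy => [|x] IHx xy.
  have := IHm 1%N isT xy; rewrite /hpow isumS -/(hpow m.+1 0) hpow0 add0r.
  rewrite !expr1n => /le_trans; apply; rewrite ler_peMl ?ler1n//.
  by rewrite mulr_ge0//; exact: (hpow_ge0 m).
rewrite /hpow isumS -/(hpow m.+1 _) -/(hpow m _) !mulrDr.
have xy' : (x.+1 <= y)%N by rewrite ltnW.
apply: le_trans (lerD (IHx isT xy') (ler_wpM2l _ (IHm x.+2 isT xy))) => //.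
rewrite mulrA -mulrDl ler_wpM2r ?rsqrt_ge0//; exact: pow_diff_le.
Qed.

(** A bump on the open interval from 0 to M that vanishes like a half power at
    both ends; truncated subtraction makes it vanish beyond M. *)
Definition hprod a b M x : R := hpow a x * hpow b (M - x)%N.

Lemma hprod_ge0 a b M x : 0 <= hprod a b M x.
Proof. by rewrite mulr_ge0// hpow_ge0. Qed.

Lemma hprod_out a b M x : ~~ (0 < x < M)%N -> hprod a b M x = 0.
Proof.
rewrite /hprod negb_and -!leqNgt leqn0 => /orP[/eqP ->|Mx].
  by rewrite hpow0 mul0r.
by rewrite (_ : (M - x)%N = 0%N) ?hpow0 ?mulr0//; apply/eqP; rewrite subn_eq0.
Qed.

(** The Leibniz rule. Differencing the reflected factor shifts its argument by
    one, and letting M grow by one absorbs this shift: differences of products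
    of half powers are again of this form. *)
Lemma bdiff_hprod a b M x :
  bdiff (hprod a.+1 b.+1 M) x = hprod a b.+1 M.+1 x - hprod a.+1 b M.+1 x.
Proof.
case: x => [|x]; first by rewrite /bdiff subrr !hprod_out ?subrr.
rewrite /bdiff /hprod subSS /=.
rewrite -(bdiff_hpow a x.+1) /bdiff /=.
have [xM|Mx] := leqP x.+1 M; last first.
  have [-> ->] : (M - x.+1 = 0)%N /\ (M - x = 0)%N by lia.
  by rewrite !hpow0; ring.
have -> : hpow b (M - x)%N = hpow b.+1 (M - x)%N - hpow b.+1 (M - x.+1)%N.
  by rewrite -(bdiff_hpow b) /bdiff -subnS.
ring.
Qed.

Lemma hprod_ub a b M x : (0 < x < M)%N ->
  hprod a b M x <= 4 * M%:R ^+ (a + b) * (rsqrt x * rsqrt (M - x)%N).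
Proof.
move=> /andP[x0 xM]; rewrite /hprod.
have h z m : (z <= M)%N -> hpow m z <= 2 * M%:R ^+ m * rsqrt z.
  move=> zM; apply: le_trans (hpow_ub _ _) _.
  by rewrite ler_wpM2r ?rsqrt_ge0// ler_pM2l// lerXn2r ?nnegrE// ler_nat.
apply: le_trans (ler_pM (hpow_ge0 _ _) (hpow_ge0 _ _) (h x a _) (h _ b _)) _.
- by rewrite ltnW.
- exact: leq_subr.
by rewrite exprD le_eqVlt; apply/orP; left; apply/eqP; ring.
Qed.

(** By the Leibniz rule every term of the m-th difference is a product of half
    powers of total degree a + b - m, and each of them carries the common factor
    1 / sqrt (x (M + m - x)). *)
Lemma iter_bdiff_hprod m a b M x : (m <= a)%N -> (m <= b)%N ->
  `|iter m bdiff (hprod a b M) x| <=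
    2 ^+ m * (4 * (M + m)%:R ^+ (a + b - m))
      * (rsqrt x * rsqrt (M + m - x)%N).
Proof.
elim: m a b M x => [|m IHm] a b M x ma mb.
  rewrite /= addn0 subn0 expr0 mul1r.
  have [xM|/hprod_out ->] := boolP (0 < x < M)%N.
    by rewrite ger0_norm ?hprod_ge0// hprod_ub.
  by rewrite normr0 !mulr_ge0 ?rsqrt_ge0// exprn_ge0.
case: a b ma mb => [|a] [|b]// ma mb.
rewrite iterSr (@eq_iter_bdiff _ m _
  (fun y => hprod a b.+1 M.+1 y + (-1) * hprod a.+1 b M.+1 y)); last first.
  by move=> y; rewrite bdiff_hprod mulN1r.
rewrite iter_bdiffD iter_bdiffZ mulN1r; apply: le_trans (ler_normB _ _) _.
have := IHm a b.+1 M.+1 x ma (leqW mb).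
have := IHm a.+1 b M.+1 x (leqW ma) mb.
rewrite !addSn !addnS !subSS => h1 h2; apply: le_trans (lerD h2 h1) _.
by rewrite exprS le_eqVlt; apply/orP; left; apply/eqP; ring.
Qed.

Lemma iter_bdiff_hprod_out m a b M x : (m <= a)%N -> (m <= b)%N ->
  ~~ (0 < x < M + m)%N -> iter m bdiff (hprod a b M) x = 0.
Proof.
move=> ma mb; have := iter_bdiff_hprod M x ma mb.
rewrite negb_and -!leqNgt leqn0 => + /orP[/eqP x0|Mx].
  by rewrite x0 rsqrt0 mul0r mulr0 normr_le0 => /eqP.
rewrite (_ : (M + m - x)%N = 0%N); last by lia.
by rewrite rsqrt0 !mulr0 normr_le0 => /eqP.
Qed.

(** By telescoping, since 1 / (n + 1) <= ln (n + 1) - ln n. *)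
Lemma harmonic_le n : (0 < n)%N -> \sum_(1 <= x < n.+1) (x%:R : R)^-1 <= 1 + ln n%:R.
Proof.
elim: n => // -[|n] IHn _; first by rewrite big_nat1 invr1 ln1 addr0.
rewrite big_nat_recr//=; apply: le_trans (lerD (IHn isT) (lexx _)) _.
rewrite -addrA lerD2l -lerBrDr -ler_expR expRD expRN !lnK ?posrE ?ltr0n//.
rewrite -expRN; set t : R := n.+2%:R^-1.
have -> : n.+1%:R = n.+2%:R * (1 + - t) :> R.
  by rewrite mulrDr mulr1 mulrN divff ?pnatr_eq0// -[n.+2%:R]natr1 addrK.
by rewrite ler_pM2l ?ltr0n// expR_ge1Dx.
Qed.

End PowerProfile.

(** * Bump and step profiles *)

Section ProfileEnergy.
Context {R : realType}.
Implicit Types (k m n x y N M Q L : nat).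
Local Notation rsqrt := (@rsqrt R).
Local Notation hpow := (@hpow R).
Local Notation hprod := (@hprod R).

(** This is x ^ (k - 1/2), with value 0 at 0. *)
Definition half_pow k x : R := x%:R ^+ k * rsqrt x.

Lemma sum_support_le (f : nat -> R) Q L : (forall x, 0 <= f x) ->
  (forall x, ~~ (0 < x < Q)%N -> f x = 0) ->
  \sum_(0 <= x < L) f x <= \sum_(1 <= x < Q) f x.
Proof.
move=> f0 fQ.
have -> : \sum_(1 <= x < Q) f x = \sum_(0 <= x < Q) f x.
  case: Q fQ => [|Q] fQ; first by rewrite !big_geq.
  by rewrite [RHS]big_nat_recl// fQ// add0r big_add1.
have [LQ|QL] := leqP L Q.
  by rewrite [leRHS](big_cat_nat _ LQ)//= lerDl sumr_ge0.
have r0 : \sum_(Q <= x < L) f x = 0.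
  by rewrite big_nat big1// => x /andP[Qx _]; rewrite fQ// negb_and -!leqNgt Qx orbT.
by rewrite (big_cat_nat _ (ltnW QL))//= r0 addr0.
Qed.

(** Partial fractions: 1 / (x (Q - x)) = (1 / x + 1 / (Q - x)) / Q. *)
Lemma sum_inv_prod_le Q :
  \sum_(1 <= x < Q) (x%:R^-1 * (Q - x)%:R^-1 : R) <= 2 * (1 + ln Q%:R) / Q%:R.
Proof.
have [->|Q0] := posnP Q; first by rewrite big_geq// invr0 mulr0.
have Q0' : (0 : R) < Q%:R by rewrite ltr0n.
have H : \sum_(1 <= x < Q) (x%:R^-1 : R) <= 1 + ln Q%:R.
  apply: le_trans (harmonic_le Q0); rewrite big_nat_recr//= lerDl invr_ge0//.
have -> : \sum_(1 <= x < Q) (x%:R^-1 * (Q - x)%:R^-1 : R) =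
    \sum_(1 <= x < Q) (x%:R^-1 + (Q - x)%:R^-1) / Q%:R.
  rewrite !big_nat; apply: eq_bigr => x /andP[x0 xQ].
  rewrite natrB 1?ltnW//; field.
  by rewrite subr_eq0 eqr_nat !pnatr_eq0 -!lt0n Q0 x0 andbT neq_ltn xQ orbT.
rewrite -mulr_suml ler_pM2r ?invr_gt0// big_split /=.
have -> : \sum_(1 <= x < Q) ((Q - x)%:R^-1 : R) = \sum_(1 <= x < Q) x%:R^-1.
  rewrite big_nat_rev /=; apply: eq_big_nat => x /andP[x0 xQ].
  by congr (_%:R^-1); lia.
by rewrite mulr_natl mulr2n lerD.
Qed.

(** The squared m-th difference is at most a constant times
    Q ^ (2 m) / (x (Q - x)) with Q = M + m; this is where the logarithm in the
    rate comes from. *)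
Lemma energy_hprod m M L :
  \sum_(0 <= x < L) iter m bdiff (hprod m m M) x ^+ 2 <=
    2 * (2 ^+ m * 4) ^+ 2 * ((M + m)%:R ^+ (2 * m) / (M + m)%:R
      * (1 + ln (M + m)%:R)).
Proof.
apply: le_trans (sum_support_le (Q := (M + m)%N) _ _ _) _.
- by move=> x; exact: sqr_ge0.
- by move=> x xQ; rewrite iter_bdiff_hprod_out// expr0n.
set Q := (M + m)%N.
apply: (@le_trans _ _ (\sum_(1 <= x < Q) (2 ^+ m * 4 * Q%:R ^+ m) ^+ 2 *
  (x%:R^-1 * (Q - x)%:R^-1))).
  apply: ler_sum => x _.
  have := @iter_bdiff_hprod R m m m M x (leqnn m) (leqnn m); rewrite addnK -/Q => h.
  rewrite -[leLHS]real_normK ?num_real// -!rsqrt_sqr -!exprMn -mulrA.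
  rewrite lerXn2r ?nnegrE//.
  by rewrite !mulr_ge0 ?rsqrt_ge0 ?exprn_ge0.
rewrite -mulr_sumr; apply: le_trans (ler_wpM2l _ (sum_inv_prod_le Q)) _.
  exact: sqr_ge0.
by rewrite !exprMn -!exprM (mulnC 2 m) le_eqVlt; apply/orP; left; apply/eqP; ring.
Qed.

(** Taking a difference of order m lengthens the support by m; this lemma
    absorbs the change of length into a constant. *)
Lemma scale_log_le j c N Q : (0 < c)%N -> (0 < N <= Q)%N -> (Q <= c * N)%N ->
  Q%:R ^+ j / Q%:R * (1 + ln Q%:R) <=
  c%:R ^+ j * (1 + ln c%:R) * (N%:R ^+ j / N%:R * (1 + ln N%:R)) :> R.
Proof.
move=> c0 /andP[N0 NQ] QcN.
have Q0 : (0 < Q)%N by apply: leq_trans NQ.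
have ln0 z : (0 < z)%N -> 0 <= ln (z%:R : R) by move=> z0; rewrite ln_ge0// ler1n.
have lnQ : ln (Q%:R : R) <= ln c%:R + ln N%:R.
  rewrite -lnM ?posrE ?ltr0n// -natrM ler_ln ?posrE ?ltr0n ?muln_gt0 ?c0//.
  by rewrite ler_nat.
have lnc := ln0 _ c0; have lnN := ln0 _ N0; have lQ := ln0 _ Q0.
apply: (@le_trans _ _ ((c%:R * N%:R) ^+ j / N%:R * ((1 + ln c%:R) * (1 + ln N%:R)))).
  apply: ler_pM.
  - by rewrite divr_ge0// exprn_ge0.
  - by rewrite addr_ge0.
  - apply: ler_pM; rewrite ?exprn_ge0 ?invr_ge0//.
      by rewrite lerXn2r ?nnegrE// -natrM ler_nat.
    by rewrite lef_pV2 ?posrE ?ltr0n// ler_nat.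
  - nra.
by rewrite exprMn le_eqVlt; apply/orP; left; apply/eqP; ring.
Qed.

Lemma half_pow_gt0 k x : (0 < x)%N -> 0 < half_pow k x.
Proof. by move=> x0; rewrite mulr_gt0 ?exprn_gt0 ?invr_gt0 ?sqrtr_gt0 ?ltr0n. Qed.

Lemma half_pow_ge0 k x : 0 <= half_pow k x.
Proof. by rewrite mulr_ge0 ?exprn_ge0 ?rsqrt_ge0. Qed.

Lemma half_pow0 k : half_pow k 0 = 0.
Proof. by rewrite /half_pow rsqrt0 mulr0. Qed.

Lemma half_powS k x : half_pow k.+1 x = x%:R ^+ k * Num.sqrt x%:R.
Proof.
rewrite /half_pow /rsqrt exprSr -mulrA; congr (_ * _).
have [->|x0] := posnP x; first by rewrite mul0r sqrtr0.
by rewrite -{1}[x%:R]sqr_sqrtr// expr2 mulfK// gt_eqF// sqrtr_gt0 ltr0n.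
Qed.

Lemma half_pow_sqr k x : half_pow k x ^+ 2 = x%:R ^+ (2 * k) / x%:R.
Proof. by rewrite exprMn rsqrt_sqr -exprM mulnC. Qed.

Lemma half_pow_sqrS k x : half_pow k.+1 x ^+ 2 = x%:R ^+ (2 * k.+1 - 1).
Proof.
rewrite half_powS exprMn sqr_sqrtr// -exprM -exprSr; congr (_ ^+ _); lia.
Qed.

Lemma half_pow_sqrt k x : (0 < k)%N -> half_pow k x = Num.sqrt (x%:R ^+ (2 * k - 1)).
Proof. by case: k => // k _; rewrite -half_pow_sqrS sqrtr_sqr ger0_norm// half_pow_ge0. Qed.

Lemma le_half_pow k x y : (0 < k)%N -> (x <= y)%N -> half_pow k x <= half_pow k y.
Proof.
case: k => // k _ xy; rewrite !half_powS ler_pM ?exprn_ge0 ?sqrtr_ge0//.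
  by rewrite lerXn2r ?nnegrE// ler_nat.
by rewrite ler_wsqrtr// ler_nat.
Qed.

Lemma le_rsqrt x y : (0 < x <= y)%N -> rsqrt y <= rsqrt x.
Proof.
move=> /andP[x0 xy]; rewrite lef_pV2 ?posrE ?sqrtr_gt0 ?ltr0n ?(leq_trans x0)//.
by rewrite ler_wsqrtr// ler_nat.
Qed.

(** The shape of the dip of the interpolating vector on a gap of length N whose
    two end knots carry the same sign: it stays above the noise weight, which is
    proportional to (distance to the nearest knot / M) ^ (k - 1/2), at an energy
    cost of order (1 + ln N) / M ^ (2 k - 1). *)
Definition bump_spec k (kap C : R) N M (B : nat -> R) : Prop :=
  [/\ (forall x, ~~ (0 < x < N)%N -> B x = 0),
      (forall x, kap * (half_pow k (minn x (N - x)) / half_pow k M) <= B x <= 1),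
      (forall x, ~~ (0 < x < N + k)%N -> iter k bdiff B x = 0) &
      (forall L, \sum_(0 <= x < L) iter k bdiff B x ^+ 2 <=
         C * ((1 + ln N%:R) / M%:R ^+ (2 * k - 1)))].

(** A multiple of the product of the half powers of order k of x and N - x. *)
Lemma bump_profile k : (0 < k)%N -> exists kap C : R, [/\ 0 < kap, 0 < C &
  forall N M, (0 < N <= M)%N -> exists B, bump_spec k kap C N M B].
Proof.
move=> k0.
pose kap : R := (4 * (k`!%:R ^+ 2 * 2 ^+ k))^-1.
pose C : R := 2 * (2 ^+ k * 4) ^+ 2 * (k.+1%:R ^+ (2 * k) * (1 + ln k.+1%:R)) / 16.
have kf0 : (0 : R) < k`!%:R by rewrite ltr0n fact_gt0.
exists kap, C; split.
- by rewrite invr_gt0 !mulr_gt0 ?exprn_gt0.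
- have : (0 : R) <= ln k.+1%:R by rewrite ln_ge0// ler1n.
  by move=> h; rewrite !(divr_gt0, mulr_gt0) ?exprn_gt0 ?mulr_gt0 ?exprn_gt0 ?ltr0n//; lra.
move=> N M /andP[N0 NM].
have M0 : (0 < M)%N by apply: leq_trans NM.
have pN := half_pow_gt0 k N0; have pM := half_pow_gt0 k M0.
pose D : R := (4 * half_pow k N * half_pow k M)^-1.
have D0 : 0 < D by rewrite invr_gt0 mulr_gt0// mulr_gt0.
exists (fun x => D * hprod k k N x); split.
- by move=> x xN; rewrite hprod_out// mulr0.
- move=> x; have [/andP[x0 xN]|xN] := boolP (0 < x < N)%N; last first.
    rewrite hprod_out// mulr0 ler01 andbT.
    rewrite (_ : minn _ _ = 0%N) ?half_pow0 ?mul0r ?mulr0//.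
    by move: xN; rewrite negb_and -!leqNgt; lia.
  apply/andP; split.
    have lb y : (0 < y)%N -> half_pow k y <= k`!%:R * hpow k y.
      by move=> y0; apply: hpow_lb; rewrite y0 leqnn.
    have half y : (0 < y <= N)%N -> (N <= 2 * y)%N -> half_pow k N <= 2 ^+ k * half_pow k y.
      move=> /andP[y0 yN] Ny; rewrite /half_pow mulrA -exprMn.
      apply: ler_pM; rewrite ?exprn_ge0 ?rsqrt_ge0 ?le_rsqrt ?y0//.
      by rewrite lerXn2r ?nnegrE// -natrM ler_nat.
    have key y z : (0 < y)%N -> (y <= z)%N -> (y + z = N)%N ->
        half_pow k y * half_pow k N <= k`!%:R ^+ 2 * 2 ^+ k * (hpow k y * hpow k z).
      move=> y0 yz yzN.
      have h1 := lb y y0; have h2 := lb z (leq_trans y0 yz).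
      have h3 : half_pow k N <= 2 ^+ k * half_pow k z by apply: half; lia.
      have h4 : half_pow k N <= 2 ^+ k * (k`!%:R * hpow k z).
        by apply: le_trans h3 _; rewrite ler_pM2l ?exprn_gt0.
      apply: le_trans (ler_pM (half_pow_ge0 _ _) (half_pow_ge0 _ _) h1 h4) _.
      by rewrite le_eqVlt; apply/orP; left; apply/eqP; ring.
    have : half_pow k (minn x (N - x)) * half_pow k N <=
        k`!%:R ^+ 2 * 2 ^+ k * hprod k k N x.
      rewrite /hprod /minn; case: ltnP => h.
        by apply: key; lia.
      by rewrite [hpow k x * _]mulrC; apply: key; lia.
    rewrite /kap /D => h.
    have k2 : (0 : R) < k`!%:R ^+ 2 * 2 ^+ k by rewrite mulr_gt0 ?exprn_gt0.
    move: h; set A : R := _ * 2 ^+ k in k2 *; set H := hprod _ _ _ _ => h.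
    set p := half_pow k (minn _ _) in h *.
    have -> : (4 * A)^-1 * (p / half_pow k M) = (p * half_pow k N) / (4 * A * half_pow k N * half_pow k M).
      by field; rewrite !gt_eqF.
    have -> : (4 * half_pow k N * half_pow k M)^-1 * H = (A * H) / (4 * A * half_pow k N * half_pow k M).
      by field; rewrite !gt_eqF.
    by rewrite ler_pM2r// invr_gt0 mulr_gt0// mulr_gt0// mulr_gt0.
  have D'0 : 0 < 4 * half_pow k N * half_pow k M by rewrite mulr_gt0// mulr_gt0.
  rewrite /D mulrC ler_pdivrMr// mul1r.
  have ub y : (y <= N)%N -> hpow k y <= 2 * half_pow k N.
    move=> yN; apply: le_trans (hpow_ub _ _) _.
    by rewrite -mulrA ler_pM2l// le_half_pow.
  apply: (@le_trans _ _ (2 * half_pow k N * (2 * half_pow k M))).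
    apply: ler_pM; rewrite ?hpow_ge0 ?ub 1?ltnW//.
    apply: le_trans (ub _ (leq_subr _ _)) _.
    by rewrite ler_pM2l// le_half_pow.
  by rewrite le_eqVlt; apply/orP; left; apply/eqP; ring.
- by move=> x xN; rewrite iter_bdiffZ iter_bdiff_hprod_out// mulr0.
move=> L.
under eq_bigr do rewrite iter_bdiffZ exprMn.
rewrite -mulr_sumr.
apply: le_trans (ler_wpM2l (sqr_ge0 _) (energy_hprod _ _ _)) _.
have sl := @scale_log_le (2 * k) k.+1 N (N + k) isT.
have h1 : (0 < N <= N + k)%N by rewrite N0 leq_addr.
have h2 : (N + k <= k.+1 * N)%N by rewrite mulSn leq_add2l leq_pmulr.
have {sl h1 h2} sl := sl h1 h2.
have c0 : (0 : R) <= D ^+ 2 * (2 * (2 ^+ k * 4) ^+ 2).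
  by rewrite mulr_ge0 ?sqr_ge0// mulr_ge0// sqr_ge0.
rewrite [leLHS]mulrA; apply: le_trans (ler_wpM2l c0 sl) _.
have pM2 : half_pow k M ^+ 2 = M%:R ^+ (2 * k - 1).
  by rewrite -(prednK k0) half_pow_sqrS.
have D2 : D ^+ 2 = (16 * (N%:R ^+ (2 * k) / N%:R) * M%:R ^+ (2 * k - 1))^-1.
  rewrite /D exprVn [in LHS]exprMn [(4 * _) ^+ 2]exprMn pM2 half_pow_sqr.
  by congr (_ * _ * _)^-1; rewrite -natrX.
rewrite D2 /C.
have M0' : (0 : R) < M%:R ^+ (2 * k - 1) by rewrite exprn_gt0 ?ltr0n.
have N0' : (0 : R) < N%:R by rewrite ltr0n.
have N1' : (0 : R) < N%:R ^+ (2 * k) by rewrite exprn_gt0.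
move: (_ ^+ (2 * k - 1)) (N%:R ^+ (2 * k)) (k.+1%:R ^+ (2 * k)) (_ ^+ 2)
  M0' N1' => m n' a e m0 n0.
by rewrite le_eqVlt; apply/orP; left; apply/eqP; field; rewrite !gt_eqF.
Qed.

End ProfileEnergy.

Section StepProfile.
Context {R : realType}.
Implicit Types (k m n x y N M Q L : nat).
Local Notation rsqrt := (@rsqrt R).
Local Notation hpow := (@hpow R).
Local Notation hprod := (@hprod R).
Local Notation half_pow := (@half_pow R).

(** Since 1 / (sqrt y sqrt z) = (1 / sqrt y + 1 / sqrt z) / (sqrt y + sqrt z) and
    sqrt y + sqrt z >= sqrt (y + z). *)
Lemma rsqrt_mul_le y Q : (0 < y < Q)%N ->
  rsqrt y * rsqrt (Q - y) <= rsqrt Q * (rsqrt y + rsqrt (Q - y)).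
Proof.
move=> /andP[y0 yQ]; have z0 : (0 < Q - y)%N by rewrite subn_gt0.
have QE : Q%:R = y%:R + (Q - y)%:R :> R by rewrite -natrD subnKC// ltnW.
rewrite /rsqrt QE; set z := (Q - y)%N in z0 *.
have u0 : 0 < Num.sqrt (y%:R : R) by rewrite sqrtr_gt0 ltr0n.
have v0 : 0 < Num.sqrt (z%:R : R) by rewrite sqrtr_gt0 ltr0n.
set u := Num.sqrt y%:R in u0 *; set v := Num.sqrt z%:R in v0 *.
have w0 : 0 < Num.sqrt (y%:R + z%:R : R) by rewrite sqrtr_gt0 addr_gt0 ?ltr0n.
have w2 : Num.sqrt (y%:R + z%:R : R) ^+ 2 = u ^+ 2 + v ^+ 2.
  by rewrite !sqr_sqrtr// addr_ge0.
set w := Num.sqrt (y%:R + z%:R) in w0 w2 *.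
have wuv : w <= u + v.
  rewrite -(@ler_sqr _ w) ?nnegrE ?ltW ?addr_gt0// w2.
  by have := mulr_gt0 u0 v0; nra.
rewrite mulrC -[leRHS]mulrC.
have -> : (u^-1 + v^-1) / w = v^-1 / u * ((u + v) / w).
  by field; rewrite !gt_eqF.
apply: ler_peMr; first by rewrite ltW// mulr_gt0 ?invr_gt0.
by rewrite ler_pdivlMr// mul1r.
Qed.

Lemma sum_hprod_le m N :
  \sum_(1 <= y < N.+1) hprod m m N.+1 y <= 16 * N.+1%:R ^+ (2 * m).
Proof.
apply: (@le_trans _ _ (\sum_(1 <= y < N.+1) 4 * N.+1%:R ^+ (m + m) *
    (rsqrt N.+1 * (rsqrt y + rsqrt (N.+1 - y))))).
  rewrite !big_nat; apply: ler_sum => y yN.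
  apply: le_trans (hprod_ub _ _ yN) _.
  by rewrite ler_wpM2l ?rsqrt_mul_le// mulr_ge0// exprn_ge0.
rewrite -mulr_sumr -mulr_sumr big_split /=.
have -> : \sum_(1 <= y < N.+1) rsqrt (N.+1 - y) = \sum_(1 <= y < N.+1) rsqrt y.
  rewrite big_nat_rev /=; apply: eq_big_nat => y /andP[y0 yN].
  by congr rsqrt; lia.
have h1 : \sum_(1 <= y < N.+1) rsqrt y <= 2 * Num.sqrt N.+1%:R.
  apply: le_trans (hpow1_le _) _.
  by rewrite ler_pM2l// ler_wsqrtr// ler_nat.
have s0 : 0 < Num.sqrt (N.+1%:R : R) by rewrite sqrtr_gt0 ltr0n.
have h2 : rsqrt N.+1 * (\sum_(1 <= y < N.+1) rsqrt y
    + \sum_(1 <= y < N.+1) rsqrt y) <= 4.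
  rewrite /rsqrt mulrC ler_pdivrMr//; lra.
have e0 : (0 : R) <= N.+1%:R ^+ (2 * m) by rewrite exprn_ge0.
rewrite addnn -mul2n.
apply: le_trans (ler_wpM2l _ h2) _; first by rewrite mulr_ge0.
lra.
Qed.

Lemma sum_hprod_ge m N x : (0 < x)%N -> (2 * x <= N.+1)%N ->
  N%:R ^+ m * rsqrt N * half_pow m.+1 x <= 2 ^+ m * m`!%:R * m.+1`!%:R *
    \sum_(1 <= y < x.+1) hprod m m N.+1 y.
Proof.
move=> x0 xN.
have h1 : half_pow m.+1 x <= m.+1`!%:R * hpow m.+1 x.
  by apply: hpow_lb; rewrite x0 leqnn.
have h2 : N%:R ^+ m * rsqrt N * hpow m.+1 x <=
    2 ^+ m * m`!%:R * \sum_(1 <= y < x.+1) hprod m m N.+1 y.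
  rewrite /hpow /= -/(hpow m) !mulr_sumr !big_nat.
  apply: ler_sum => y /andP[y0 yx].
  have yN : (0 < N.+1 - y <= N)%N by lia.
  have := @hpow_lb R m _ _ yN => h.
  have h3 : N%:R ^+ m * rsqrt N <= 2 ^+ m * (m`!%:R * hpow m (N.+1 - y)).
    apply: le_trans (ler_wpM2l _ h); last by rewrite exprn_ge0.
    rewrite mulrA -exprMn ler_wpM2r ?rsqrt_ge0// lerXn2r ?nnegrE//.
    by rewrite -natrM ler_nat; lia.
  apply: le_trans (ler_wpM2r (hpow_ge0 _ _) h3) _.
  by rewrite /hprod le_eqVlt; apply/orP; left; apply/eqP; ring.
have c0 : 0 <= N%:R ^+ m * rsqrt N by rewrite mulr_ge0 ?exprn_ge0 ?rsqrt_ge0.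
apply: le_trans (ler_wpM2l c0 h1) _.
rewrite mulrCA [leRHS]mulrAC -[leRHS]mulrA mulrC [leRHS]mulrC [leRHS]mulrA.
rewrite [leRHS]mulrC.
have := ler_wpM2l (ler0n R (m.+1`!)) h2.
by rewrite mulrC; congr (_ <= _); ring.
Qed.

(** The shape of the transition of the interpolating vector on a gap of length N
    across which the sign changes: at distance d from either end it has already
    left the end value by a multiple of (d / N) ^ (k - 1/2), at an energy cost of
    order (1 + ln N) / N ^ (2 k - 1). *)
Definition step_spec k (kap C : R) N (T : nat -> R) : Prop :=
  [/\ T 0%N = 0 /\ (forall x, (N <= x)%N -> T x = 1),
      (forall x, (x <= N)%N ->
         kap * (half_pow k (minn x (N - x)) / half_pow k N) <= T x <=
         1 - kap * (half_pow k (minn x (N - x)) / half_pow k N)),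
      (forall x, ~~ (0 < x < N + k)%N -> iter k bdiff T x = 0) &
      (forall L, \sum_(0 <= x < L) iter k bdiff T x ^+ 2 <=
         C * ((1 + ln N%:R) / N%:R ^+ (2 * k - 1)))].

(** The step is the normalized running sum of the bump built from half powers of
    order k - 1. Its k-th difference is then the (k - 1)-th difference of the
    bump divided by the total mass, which is of order N ^ (2 (k - 1)); the
    symmetry of the bump exchanges the two ends of the step. *)
Lemma step_profile k : (0 < k)%N -> exists kap C : R, [/\ 0 < kap, 0 < C &
  forall N, (0 < N)%N -> exists T, step_spec k kap C N T].
Proof.
case: k => // m _.
pose F : R := 2 ^+ m * m`!%:R * m.+1`!%:R.
have F0 : 0 < F by rewrite mulr_gt0 ?mulr_gt0 ?exprn_gt0 ?ltr0n ?fact_gt0.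
(* The total mass lies between N ^ (2 m) / (2 ^ (m + 1) F) and
   16 (2 N) ^ (2 m). *)
pose kap : R := (F * (16 * 2 ^+ (2 * m)))^-1.
pose A : R := m.+2%:R ^+ (2 * m) * (1 + ln m.+2%:R).
pose C : R := 2 * (2 ^+ m * 4) ^+ 2 * A * (2 ^+ m.+1 * F) ^+ 2.
have lm0 : (0 : R) <= ln m.+2%:R by rewrite ln_ge0// ler1n.
have A0 : 0 < A by rewrite mulr_gt0 ?exprn_gt0 ?ltr0n//; lra.
exists kap, C; split.
- by rewrite invr_gt0 mulr_gt0// mulr_gt0 ?exprn_gt0.
- rewrite /C; have : (0 : R) < (2 ^+ m * 4) ^+ 2 by rewrite exprn_gt0// mulr_gt0 ?exprn_gt0.
  have : (0 : R) < (2 ^+ m.+1 * F) ^+ 2 by rewrite exprn_gt0// mulr_gt0 ?exprn_gt0.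
  by move=> h1 h2; rewrite mulr_gt0// mulr_gt0// mulr_gt0.
move=> N N0.
have N0' : (0 : R) < N%:R by rewrite ltr0n.
pose G := hprod m m N.+1.
pose Sg x := \sum_(1 <= y < x.+1) G y.
have G0 y : 0 <= G y by exact: hprod_ge0.
have Sg_mono x y : (x <= y)%N -> Sg x <= Sg y.
  move=> xy; rewrite /Sg [leRHS](@big_cat_nat _ _ _ x.+1)//=.
  by rewrite lerDl sumr_ge0.
have Sg_sym x : (x <= N)%N -> Sg x + Sg (N - x)%N = Sg N.
  move=> xN; rewrite [RHS](@big_cat_nat _ _ _ x.+1)//=; congr (_ + _).
  rewrite -[x.+1]add1n big_addn subSn// /Sg [LHS]big_nat_rev /=.
  apply: eq_big_nat => y /andP[y0 yN]; rewrite /G /hprod mulrC.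
  by congr (hpow _ _ * hpow _ _); lia.
have SgE x : (N <= x)%N -> Sg x = Sg N.
  move=> Nx; rewrite /Sg [LHS](@big_cat_nat _ _ _ N.+1)//=.
  have -> : \sum_(N.+1 <= y < x.+1) G y = 0; last by rewrite addr0.
  rewrite big_nat big1// => y /andP[Ny _].
  by rewrite /G hprod_out// negb_and -!leqNgt Ny orbT.
have SgN_lb : N%:R ^+ (2 * m) <= 2 ^+ m.+1 * F * Sg N.
  (* Half of the mass suffices, and hpow is controlled there. *)
  pose x := uphalf N.
  have := @sum_hprod_ge m N x; rewrite -/F -/G -/(Sg x) => h.
  have h0 : (0 < x)%N by rewrite /x uphalf_half; lia.
  have h1 : (2 * x <= N.+1)%N by rewrite /x uphalf_half; lia.
  have h2 : (N <= 2 * x)%N by rewrite /x uphalf_half; lia.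
  have h3 : (x <= N)%N by lia.
  have {}h := h h0 h1.
  have h4 : N%:R ^+ m.+1 * rsqrt N <= 2 ^+ m.+1 * half_pow m.+1 x.
    rewrite /half_pow mulrA -exprMn; apply: ler_pM; rewrite ?exprn_ge0 ?rsqrt_ge0//.
      by rewrite lerXn2r ?nnegrE// -natrM ler_nat.
    by rewrite le_rsqrt// h0.
  have c0 : 0 <= N%:R ^+ m * rsqrt N by rewrite mulr_ge0 ?exprn_ge0 ?rsqrt_ge0.
  have h5 := ler_wpM2l c0 h4.
  have E : N%:R ^+ m * rsqrt N * (N%:R ^+ m.+1 * rsqrt N) = N%:R ^+ (2 * m).
    rewrite (_ : _ * _ = N%:R ^+ m * N%:R ^+ m * N%:R * rsqrt N ^+ 2); last first.
      by rewrite exprS; ring.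
    by rewrite rsqrt_sqr mulfK ?gt_eqF// -exprD addnn -mul2n.
  rewrite -E; apply: le_trans h5 _; rewrite mulrCA -mulrA ler_pM2l ?exprn_gt0//.
  by apply: le_trans h _; rewrite ler_pM2l//; exact: Sg_mono.
have SgN0 : 0 < Sg N.
  have : 0 < 2 ^+ m.+1 * F * Sg N.
    by apply: lt_le_trans SgN_lb; rewrite exprn_gt0.
  by rewrite pmulr_rgt0// mulr_gt0 ?exprn_gt0.
have SgN_ub : Sg N <= 16 * 2 ^+ (2 * m) * N%:R ^+ (2 * m).
  apply: le_trans (sum_hprod_le _ _) _.
  rewrite -mulrA -exprMn ler_pM2l// lerXn2r ?nnegrE//.
  by rewrite -natrM ler_nat; lia.
pose T x := (Sg N)^-1 * Sg x.
have Tsym x : (x <= N)%N -> T x + T (N - x)%N = 1.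
  by move=> xN; rewrite -mulrDr Sg_sym// mulVf// gt_eqF.
have T_mono x y : (x <= y)%N -> T x <= T y.
  by move=> xy; rewrite ler_pM2l ?invr_gt0// Sg_mono.
have T0 : T 0%N = 0 by rewrite /T [Sg 0%N]big_geq// mulr0.
have iterT x : iter m.+1 bdiff T x = (Sg N)^-1 * iter m bdiff G x.
  rewrite /T iter_bdiffZ; congr (_ * _); rewrite iterSr.
  by apply: eq_iter_bdiff => y; rewrite (@bdiff_isum _ 0)// /G hprod_out.
have lbhalf x : (2 * x <= N.+1)%N -> kap * (half_pow m.+1 x / half_pow m.+1 N) <= T x.
  have [->|x0] := posnP x; first by rewrite half_pow0 mul0r mulr0 T0.
  move=> h; have := @sum_hprod_ge m N x x0 h; rewrite -/F -/G -/(Sg x) => {}h.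
  have p0 := @half_pow_gt0 R m.+1 _ N0.
  have px := @half_pow_ge0 R m.+1 x.
  have E : N%:R ^+ m * rsqrt N * half_pow m.+1 N = N%:R ^+ (2 * m).
    rewrite /half_pow (_ : _ * _ = N%:R ^+ m * N%:R ^+ m * N%:R * rsqrt N ^+ 2); last first.
      by rewrite exprS; ring.
    by rewrite rsqrt_sqr mulfK ?gt_eqF// -exprD addnn -mul2n.
  have K0 : (0 : R) < 2 ^+ (2 * m) by rewrite exprn_gt0.
  rewrite /T [leRHS]mulrC ler_pdivlMr//.
  have -> : kap * (half_pow m.+1 x / half_pow m.+1 N) * Sg N =
      half_pow m.+1 x * Sg N / (F * (16 * 2 ^+ (2 * m)) * half_pow m.+1 N).
    by rewrite /kap; field; rewrite !gt_eqF.
  rewrite ler_pdivrMr; last by rewrite mulr_gt0// mulr_gt0// mulr_gt0.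
  apply: le_trans (ler_wpM2l px SgN_ub) _.
  rewrite -E.
  have c0 : (0 : R) <= 16 * 2 ^+ (2 * m) * half_pow m.+1 N.
    by rewrite ltW// mulr_gt0// mulr_gt0.
  have := ler_wpM2l c0 h.
  by congr (is_true (_ <= _)); ring.
exists T; split.
- by split=> // x Nx; rewrite /T SgE// mulVf// gt_eqF.
- move=> x xN.
  have lb y : (y <= N)%N -> kap * (half_pow m.+1 (minn y (N - y)) / half_pow m.+1 N) <= T y.
    move=> yN; apply: (@le_trans _ _ (T (minn y (N - y)))).
      by apply: lbhalf; lia.
    by apply: T_mono; exact: geq_minl.
  rewrite lb//= lerBrDr addrC -lerBrDr -(Tsym _ xN) addrC addKr.
  have := lb _ (leq_subr x N); rewrite subKn// minnC.
  by [].
- by move=> x xN; rewrite iterT iter_bdiff_hprod_out ?mulr0// addSnnS.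
move=> L; under eq_bigr do rewrite iterT exprMn.
rewrite -mulr_sumr.
apply: le_trans (ler_wpM2l (sqr_ge0 _) (energy_hprod _ _ _)) _.
have h1 : (0 < N <= N.+1 + m)%N by rewrite N0/= addSn -addnS leq_addr.
have h2 : (N.+1 + m <= m.+2 * N)%N.
  by rewrite addSn -addnS mulSn leq_add2l leq_pmulr.
have sl := @scale_log_le R (2 * m) m.+2 N _ isT h1 h2; rewrite -/A in sl.
have c0 : (0 : R) <= (Sg N)^-1 ^+ 2 * (2 * (2 ^+ m * 4) ^+ 2).
  by rewrite mulr_ge0 ?sqr_ge0// mulr_ge0// sqr_ge0.
rewrite [leLHS]mulrA; apply: le_trans (ler_wpM2l c0 sl) _.
have lN0 : (0 : R) <= 1 + ln N%:R by rewrite addr_ge0// ln_ge0// ler1n.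
have SS : (Sg N)^-1 ^+ 2 <= (2 ^+ m.+1 * F) ^+ 2 / (N%:R ^+ (2 * m)) ^+ 2.
  have n0 : (0 : R) < N%:R ^+ (2 * m) by rewrite exprn_gt0.
  have b0 : 0 < 2 ^+ m.+1 * F by rewrite mulr_gt0 ?exprn_gt0.
  have i0 : 0 <= (Sg N)^-1 by rewrite invr_ge0 ltW.
  have d0 : 0 <= 2 ^+ m.+1 * F / N%:R ^+ (2 * m) by rewrite divr_ge0// ltW.
  rewrite -expr_div_n lerXn2r ?nnegrE// ler_pdivlMr// mulrC ler_pdivrMr//.
apply: (@le_trans _ _ ((2 ^+ m.+1 * F) ^+ 2 / (N%:R ^+ (2 * m)) ^+ 2 *
  (2 * (2 ^+ m * 4) ^+ 2) * (A * (N%:R ^+ (2 * m) / N%:R * (1 + ln N%:R))))).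
  have a0 := ltW A0.
  have e0 : (0 : R) <= (2 ^+ m * 4) ^+ 2 by exact: sqr_ge0.
  have n0 : (0 : R) <= N%:R ^+ (2 * m) / N%:R by rewrite divr_ge0// exprn_ge0.
  apply: ler_wpM2r; first by rewrite mulr_ge0// mulr_ge0.
  by apply: ler_wpM2r SS; rewrite mulr_ge0.
have -> : (2 * m.+1 - 1 = (2 * m).+1)%N by rewrite mulnS.
rewrite [N%:R ^+ (2 * m).+1]exprS /C.
have : (0 : R) < N%:R ^+ (2 * m) by rewrite exprn_gt0.
move: (N%:R ^+ (2 * m)) ((2 ^+ m.+1 * F) ^+ 2) ((2 ^+ m * 4) ^+ 2) => a b c a0.
rewrite le_eqVlt; apply/orP; left; apply/eqP; field.
by rewrite !gt_eqF.
Qed.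

End StepProfile.

(** * Interpolation of the signs at the knots *)

Section Interpolation.
Context {R : realType}.
Implicit Types (k m n x y N M Q L s : nat).
Local Notation half_pow := (@half_pow R).

(** Expand the nonnegative sum of the squares (K a_j - act_j A)^2, where A is the
    sum of the a_j. *)
Lemma sqr_sum_active (n K : nat) (a : nat -> R) (act : pred nat) : (0 < K)%N ->
  (forall j, ~~ act j -> a j = 0) ->
  (\sum_(0 <= j < n) act j <= K)%N ->
  (\sum_(0 <= j < n) a j) ^+ 2 <= K%:R * \sum_(0 <= j < n) a j ^+ 2.
Proof.
move=> K0 a0 cK; set A := \sum_(0 <= j < n) a j.
have K0' : (0 : R) < K%:R by rewrite ltr0n.
have sqE (x : R) : \sum_(0 <= j < n) (K%:R * a j - (act j)%:R * x) ^+ 2 =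
    K%:R ^+ 2 * (\sum_(0 <= j < n) a j ^+ 2) - 2 * K%:R * x * A
     + x ^+ 2 * (\sum_(0 <= j < n) act j)%N%:R.
  rewrite natr_sum /A !mulr_sumr -sumrB -big_split /=; apply: eq_bigr => j _.
  by case: (boolP (act j)) => [_|/a0 ->] /=; ring.
have : 0 <= \sum_(0 <= j < n) (K%:R * a j - (act j)%:R * A) ^+ 2.
  by apply: sumr_ge0 => j _; exact: sqr_ge0.
rewrite sqE.
have : (\sum_(0 <= j < n) act j)%N%:R <= K%:R :> R by rewrite ler_nat.
move=> /(ler_wpM2l (sqr_ge0 A)) h1 h2.
rewrite -subr_ge0 -(pmulr_rge0 _ K0').
by apply: le_trans h2 _; move: h1; lra.
Qed.

(** Two simultaneously active gaps have indices that differ by less than k, because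
    consecutive knots are at distance at least 1. *)
Lemma active_count k s (t : nat -> nat) x : (0 < k)%N ->
  (forall i, (i <= s)%N -> (t i < t i.+1)%N) ->
  (\sum_(0 <= j < s.+1) (t j < x < t j.+1 + k)%N <= k)%N.
Proof.
move=> k0 tS.
(* As long as the count c is positive, the last active gap and the strict
   monotonicity of t force c + x <= t n + k. *)
suff H n : (n <= s.+1)%N -> let c := (\sum_(0 <= j < n) (t j < x < t j.+1 + k)%N)%N in
  (c <= k)%N /\ ((c + x <= t n + k)%N \/ c = 0%N).
  by have [] := H s.+1 (leqnn _).
elim: n => [|n IHn] ns; first by rewrite big_geq//; split; [|right].
have {IHn} := IHn (ltnW ns); rewrite big_nat_recr//=.
have := tS n ns; set c := (\sum_(_ <= _ < _) _)%N.
case: (boolP (t n < x < t n.+1 + k)%N) => /= h; lia.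
Qed.

Lemma sum_shift_le (f : nat -> R) L m : (forall x, 0 <= f x) -> f 0%N = 0 ->
  \sum_(0 <= x < L) f (x - m)%N <= \sum_(0 <= x < L) f x.
Proof.
move=> f0 f00; have [mL|Lm] := leqP m L; last first.
  rewrite big_nat big1 ?sumr_ge0// => x /andP[_ xL].
  by rewrite (_ : (x - m = 0)%N)//; lia.
rewrite (@big_cat_nat _ _ _ m)//= big_nat big1 ?add0r => [|x xm]; last first.
  by rewrite (_ : (x - m = 0)%N)//; lia.
rewrite -{1}[m]add0n big_addn.
under eq_bigr do rewrite addnK.
rewrite [leRHS](@big_cat_nat _ _ _ (L - m))//= ?leq_subr//.
by rewrite lerDl sumr_ge0.
Qed.

(** A sequence Z that takes the signs q at the knots, keeps a margin below 1 in
    absolute value away from them, and has a k-th difference of small energy. Z is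
    a superposition of contributions of the gaps, a step times the jump of q or a
    bump times the common sign, each of which is constant outside its gap, so that
    the k-th difference of each lives on its own gap up to k extra positions. At
    most k of these differences overlap, hence the energies add up to a factor k. *)
Lemma interpolation k : (0 < k)%N -> exists kap C : R, [/\ 0 < kap, 0 < C &
  forall s (t : nat -> nat) (q : nat -> R) (sc : pred nat) M,
  (forall i, (i <= s)%N -> (t i < t i.+1)%N) ->
  (forall i, (i <= s)%N -> (t i.+1 - t i <= M)%N) ->
  q 0%N = 0 -> q s.+1 = 0 -> (forall i, `|q i| <= 1) ->
  (forall i, (i <= s)%N -> sc i.+1 -> q i * q i.+1 <= 0) ->
  (forall i, (i <= s)%N -> ~~ sc i.+1 -> q i.+1 = q i) ->
  exists Z : nat -> R,
  [/\ (forall x, (x <= t 0)%N -> Z x = 0) /\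
        (forall x, (t s.+1 <= x)%N -> Z x = 0),
      (forall i, (i <= s)%N -> Z (t i) = q i),
      (forall i x, (i <= s)%N -> (t i <= x <= t i.+1)%N ->
        `|Z x| <= 1 - kap * (half_pow k (minn (x - t i) (t i.+1 - x)) / half_pow k M)) &
      (forall L, \sum_(0 <= x < L) iter k bdiff Z x ^+ 2 <= C *
        (\sum_(1 <= i < s.+2 | sc i)
            (1 + ln (t i - t i.-1)%:R) / (t i - t i.-1)%:R ^+ (2 * k - 1)
         + \sum_(1 <= i < s.+2 | ~~ sc i)
            (1 + ln (t i - t i.-1)%:R) / M%:R ^+ (2 * k - 1)))]].
Proof.
move=> k0.
have [kT [CT [kT0 CT0 HT]]] := @step_profile R k k0.
have [kB [CB [kB0 CB0 HB]]] := @bump_profile R k k0.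
exists (Num.min kT kB), (k%:R * (4 * CT + CB)); split.
- by rewrite lt_min kT0.
- by rewrite mulr_gt0 ?ltr0n//; lra.
move=> s t q sc M tS tM q0 qs q1 qsc qnsc.
have /choice [T {}HT] : forall N, exists T, (0 < N)%N -> step_spec k kT CT N T.
  move=> [|N]; first by exists (fun=> 0).
  by have [T hT] := HT N.+1 isT; exists T.
have /choice [B {}HB] : forall N, exists B, (0 < N <= M)%N -> bump_spec k kB CB N M B.
  move=> N; have [h|h] := boolP (0 < N <= M)%N; last by exists (fun=> 0).
  by have [B hB] := HB _ _ h; exists B.
pose g j := (t j.+1 - t j)%N.
have g0 j : (j <= s)%N -> (0 < g j)%N by move=> js; rewrite subn_gt0 tS.
have gM j : (j <= s)%N -> (0 < g j <= M)%N by move=> js; rewrite g0// tM.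
have tmono i j : (i <= j)%N -> (j <= s.+1)%N -> (t i <= t j)%N.
  move=> ij; elim: j ij => [|j IHj]; first by rewrite leqn0 => /eqP ->.
  rewrite leq_eqVlt => /predU1P[->//|ij] js.
  by apply: leq_trans (IHj ij (ltnW js)) _; rewrite ltnW// tS.
pose b j := if sc j.+1 then 0 else q j.+1.
pose e j x := (q j.+1 - q j) * T (g j) x + (- b j) * B (g j) x.
pose Z x := \sum_(0 <= j < s.+1) e j (x - t j)%N.
have e0 j : (j <= s)%N -> e j 0%N = 0.
  move=> js; have [[T0 _] _ _ _] := HT _ (g0 j js).
  by have [B0 _ _ _] := HB _ (gM j js); rewrite /e T0 B0// !mulr0 addr0.
have e1 j x : (j <= s)%N -> (g j <= x)%N -> e j x = q j.+1 - q j.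
  move=> js gx; have [[_ T1] _ _ _] := HT _ (g0 j js).
  have [B0 _ _ _] := HB _ (gM j js); rewrite /e T1// B0 ?mulr1 ?mulr0 ?addr0//.
  by rewrite negb_and -!leqNgt gx orbT.
(* To the left of the gap i the contributions telescope to q i, and the gaps to
   its right contribute 0. *)
have ZE i x : (i <= s.+1)%N -> (t i <= x)%N -> (x <= t (minn i.+1 s.+1))%N ->
    Z x = q i + (if (i <= s)%N then e i (x - t i)%N else 0).
  move=> is1 tx xt; rewrite /Z (@big_cat_nat _ _ _ i)//=.
  have -> : \sum_(0 <= j < i) e j (x - t j)%N = q i.
    rewrite big_nat (eq_bigr (fun j => q j.+1 - q j)).
      by rewrite -big_nat telescope_sumr// q0 subr0.
    move=> j /andP[_ ji]; apply: e1; first by lia.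
    by apply: leq_sub2r; apply: leq_trans tx; apply: tmono.
  congr (_ + _); case: leqP => ils; last by rewrite big_geq.
  rewrite big_ltn// big_nat big1 ?addr0// => j /andP[ij js].
  rewrite (_ : (x - t j = 0)%N) ?e0//.
  apply/eqP; rewrite subn_eq0; apply: leq_trans xt _.
  by rewrite (minn_idPl _)//; apply: tmono => //; rewrite ltnW.
have Zend x : (t s.+1 <= x)%N -> Z x = 0.
  move=> tx; rewrite /Z big_nat (eq_bigr (fun j => q j.+1 - q j)).
    by rewrite -big_nat telescope_sumr// q0 qs subr0.
  move=> j /andP[_ js]; apply: e1 => //; apply: leq_sub2r.
  by apply: leq_trans tx; apply: tmono.
exists Z; split.
- split=> // x xt; rewrite /Z big_nat big1// => j /andP[_ js].
  rewrite (_ : (x - t j = 0)%N) ?e0//.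
  by apply/eqP; rewrite subn_eq0 (leq_trans xt)// tmono// ltnW.
- move=> i is1; rewrite (ZE i)//; last by apply: tmono; lia.
  + by rewrite subnn is1 e0// addr0.
  + exact: leqW.
- move=> i x is1 /andP[tx xt]; rewrite (ZE i)//; last by rewrite (minn_idPl _).
    rewrite is1.
    have pM : 0 < half_pow k M by apply: half_pow_gt0; have := gM i is1; lia.
    have pg : 0 < half_pow k (g i) by apply: half_pow_gt0; exact: g0.
    have xE : (t i.+1 - x = g i - (x - t i))%N by rewrite /g; lia.
    have xg : (x - t i <= g i)%N by apply: leq_sub2r.
    rewrite xE; set y := (x - t i)%N in xg *.
    set d := half_pow k (minn y (g i - y)).
    have d0 : 0 <= d by exact: half_pow_ge0.
    have [_ /(_ y xg) HTy _ _] := HT _ (g0 i is1).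
    have [_ /(_ y) HBy _ _] := HB _ (gM i is1).
    rewrite -/d in HTy HBy.
    have dpM : 0 <= d / half_pow k M by rewrite divr_ge0// ltW.
    rewrite /e /b; case: (boolP (sc i.+1)) => [sci|nsci].
      have h1 : Num.min kT kB * (d / half_pow k M) <= kT * (d / half_pow k (g i)).
        apply: ler_pM => //; [by rewrite le_min !ltW|by rewrite ge_min lexx|].
        by apply: ler_wpM2l => //; rewrite lef_pV2 ?posrE// le_half_pow// tM.
      set c := Num.min kT kB * (d / half_pow k M) in h1 *.
      set c' := kT * (d / half_pow k (g i)) in HTy h1.
      have c0 : 0 <= c by rewrite mulr_ge0// le_min !ltW.
      have := qsc i is1 sci; have := q1 i; have := q1 i.+1.
      move: (q i) (q i.+1) (T (g i) y) HTy => u v z /andP[z1 z2].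
      rewrite !ler_norml => /andP[v1 v2] /andP[u1 u2] uv.
      rewrite oppr0 mul0r addr0 (_ : u + (v - u) * z = (1 - z) * u + z * v); last by ring.
      have z0 : 0 <= z by lra.
      have z1' : 0 <= 1 - z by lra.
      have m1 := ler_wpM2l z1' u1; have m2 := ler_wpM2l z1' u2.
      have m3 := ler_wpM2l z0 v1; have m4 := ler_wpM2l z0 v2.
      have [u0|u0|u0] := ltrgtP u 0.
      + have v0 : 0 <= v by rewrite -(nmulr_rle0 _ u0).
        have m5 := mulr_ge0 z0 v0; have m6 := ler_wpM2l z1' (ltW u0).
        by move: m1 m2 m3 m4 m5 m6; move: (_ * u) (_ * v) => p p'; lra.
      + have v0 : v <= 0 by rewrite -(pmulr_rle0 _ u0).
        have m5 := ler_wpM2l z0 v0; have m6 := mulr_ge0 z1' (ltW u0).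
        by move: m1 m2 m3 m4 m5 m6; move: (_ * u) (_ * v) => p p'; lra.
      + by rewrite u0 mulr0 add0r; move: m3 m4; move: (_ * v) => p'; lra.
    rewrite (qnsc i)// subrr mul0r add0r.
    have h1 : Num.min kT kB * (d / half_pow k M) <= kB * (d / half_pow k M).
      by apply: ler_wpM2r => //; rewrite ge_min lexx orbT.
    rewrite (_ : _ + _ = q i * (1 - B (g i) y)); last by ring.
    move/andP: HBy => [b1 b2]; rewrite normrM.
    apply: (@le_trans _ _ (1 * `|1 - B (g i) y|)).
      by apply: ler_wpM2r.
    by rewrite mul1r ger0_norm ?subr_ge0// lerB// (le_trans h1).
  exact: leqW.
move=> L.
have iterZ x : iter k bdiff Z x = \sum_(0 <= j < s.+1) iter k bdiff (e j) (x - t j)%N.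
  by rewrite iter_bdiff_sum; apply: eq_bigr => j _; rewrite iter_bdiff_shift.
pose e' j x := if (j <= s)%N then iter k bdiff (e j) x else 0.
have iterZ' x : iter k bdiff Z x = \sum_(0 <= j < s.+1) e' j (x - t j)%N.
  rewrite iterZ !big_nat; apply: eq_bigr => j /andP[_ js].
  by rewrite /e' -ltnS js.
have e'E j y : (j <= s)%N -> e' j y =
    (q j.+1 - q j) * iter k bdiff (T (g j)) y + (- b j) * iter k bdiff (B (g j)) y.
  by move=> js; rewrite /e' js /e iter_bdiffD !iter_bdiffZ.
have e'out j y : ~~ (0 < y < g j + k)%N -> e' j y = 0.
  move=> h; rewrite {1}/e'; case: leqP => // js; have := e'E j y js.
  rewrite /e' js => ->.
  have [_ _ HT3 _] := HT _ (g0 j js); have [_ _ HB3 _] := HB _ (gM j js).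
  by rewrite HT3// HB3// !mulr0 addr0.
apply: (@le_trans _ _ (k%:R * \sum_(0 <= j < s.+1) \sum_(0 <= x < L) e' j x ^+ 2)).
  apply: (@le_trans _ _ (\sum_(0 <= x < L) k%:R *
      \sum_(0 <= j < s.+1) e' j (x - t j)%N ^+ 2)).
    apply: ler_sum => x _; rewrite iterZ'.
    apply: (sqr_sum_active (act := fun j => (t j < x < t j.+1 + k)%N)) => //.
      move=> j h.
      have [js|js] := leqP j s; last by rewrite /e' leqNgt js.
      by apply: e'out; move: h; have := tS j js; rewrite /g; lia.
    exact: active_count.
  rewrite -mulr_sumr ler_wpM2l// exchange_big /=; apply: ler_sum => j _.
  apply: (sum_shift_le (f := fun x => e' j x ^+ 2)) => [x|]; first exact: sqr_ge0.
  by rewrite e'out ?expr0n.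
rewrite -mulrA ler_wpM2l// !big_add1 /=.
rewrite [X in _ * (X + _)]big_mkcond [X in _ * (_ + X)]big_mkcond -big_split /=.
rewrite mulr_sumr !big_nat; apply: ler_sum => j /andP[_ js].
rewrite -/(g j).
have sq4 : (q j.+1 - q j) ^+ 2 <= 4.
  have := q1 j; have := q1 j.+1; rewrite !ler_norml.
  by move=> /andP[a1 a2] /andP[a3 a4]; nra.
have lg0 : 0 <= 1 + ln (g j)%:R :> R by rewrite addr_ge0// ln_ge0// ler1n g0.
have [_ _ _ /(_ L) HT4] := HT _ (g0 j js); have [_ _ _ /(_ L) HB4] := HB _ (gM j js).
case: (boolP (sc j.+1)) => [sci|nsci] /=.
  rewrite addr0.
  under eq_bigr do rewrite e'E// /b sci oppr0 mul0r addr0 exprMn.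
  rewrite -mulr_sumr.
  have d0 : 0 <= (1 + ln (g j)%:R) / (g j)%:R ^+ (2 * k - 1) :> R.
    by rewrite divr_ge0// exprn_ge0.
  apply: (@le_trans _ _ (4 * (CT * ((1 + ln (g j)%:R) / (g j)%:R ^+ (2 * k - 1))))).
    apply: ler_pM => //; first exact: sqr_ge0.
    by apply: sumr_ge0 => x _; exact: sqr_ge0.
  by rewrite mulrA ler_wpM2r// lerDl ltW.
rewrite add0r.
under eq_bigr do rewrite e'E// /b (negbTE nsci) (qnsc j)// subrr mul0r add0r exprMn.
rewrite -mulr_sumr sqrrN.
have d0 : 0 <= (1 + ln (g j)%:R) / M%:R ^+ (2 * k - 1) :> R.
  by rewrite divr_ge0// exprn_ge0.
apply: (@le_trans _ _ (1 * (CB * ((1 + ln (g j)%:R) / M%:R ^+ (2 * k - 1))))).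
  apply: ler_pM => //; first exact: sqr_ge0.
    by apply: sumr_ge0 => x _; exact: sqr_ge0.
  by rewrite -[leLHS]real_normK ?num_real// expr_le1.
by rewrite mul1r ler_wpM2r//; lra.
Qed.

End Interpolation.

(** * Green functions of the difference operator *)

Section DifferenceOperator.
Context {R : realType}.
Variables n k : nat.
Hypothesis kn : (k <= n)%N.
Local Notation D := (diff_op R n k).

Lemma sum_window (F : nat -> R) a m N : (a + m < N)%N ->
  \sum_(0 <= j < N | (a <= j <= a + m)%N) F j = \sum_(i < m.+1) F (a + i)%N.
Proof.
move=> amN; rewrite -(big_mkord xpredT (fun i => F (a + i)%N)).
transitivity (\sum_(0 + a <= j < a + m.+1) F j).
  rewrite add0n (big_nat_widen _ (a + m.+1) N) ?addnS//=.
  rewrite (big_nat_widenl a 0)//; apply: eq_bigl => j /=.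
  by rewrite ltnS andbC.
by rewrite big_addn addKn; apply: eq_bigr => i _; rewrite addnC.
Qed.

Lemma diff_op_mulE (h : 'cV[R]_n) (f : nat -> R) (r : 'I_(n - k)) :
  (forall j : 'I_n, h j 0 = f j) -> (D *m h) r 0 = iter k bdiff f (k + r)%N.
Proof.
move=> hf; rewrite mxE iter_bdiffE.
pose F j := (-1) ^+ (k + r - j) * 'C(k, k + r - j)%:R * f j : R.
have rn : (r + k < n)%N by have := ltn_ord r; lia.
transitivity (\sum_(0 <= j < n | (r <= j <= r + k)%N) F j).
  rewrite big_mkord [RHS]big_mkcond; apply: eq_bigr => j _.
  by rewrite !mxE hf /F [(r + k)%N]addnC; case: ifP => // _; rewrite mul0r.
rewrite sum_window// (reindex_inj rev_ord_inj) /=.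
apply: eq_bigr => -[l lk] _ /=; rewrite /F subSS.
rewrite (_ : (k + r - (r + (k - l)) = l)%N); last by lia.
by rewrite (_ : (r + (k - l) = k + r - l)%N)//; lia.
Qed.

(** The transpose is, up to the sign, again a k-th difference: that of z extended
    by 0 outside the row indices. This extension is why the interpolating vector
    has to join the value 0 beyond the first and the last knot. *)
Lemma trmx_diff_op_mulE (z : 'cV[R]_(n - k)) (Z : nat -> R) (j : 'I_n) :
  (forall r, z r 0 = Z (k + r).+1) ->
  (forall x, (x <= k)%N -> Z x = 0) -> (forall x, (n < x)%N -> Z x = 0) ->
  (D^T *m z) j 0 = (-1) ^+ k * iter k bdiff Z (j + k).+1.
Proof.
move=> zZ Zk Zn; rewrite mxE.
pose F p := (-1) ^+ (p - j) * 'C(k, p - j)%:R * Z p.+1 : R.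
have jn := ltn_ord j.
pose G p := if (j <= p <= j + k)%N then F p else 0.
transitivity (\sum_(0 <= p < n + k.+1 | (j <= p <= j + k)%N) F p).
  rewrite [RHS]big_mkcond -/(G _) [RHS](@big_cat_nat _ _ _ k)//=; last by lia.
  rewrite [X in _ + X](@big_cat_nat _ _ _ n)//=; last by lia.
  have -> : \sum_(0 <= p < k) G p = 0.
    rewrite big_nat big1// => p /andP[_ pk]; rewrite /G /F Zk//.
    by rewrite mulr0 if_same.
  have -> : \sum_(n <= p < n + k.+1) G p = 0.
    rewrite big_nat big1// => p /andP[np _]; rewrite /G /F Zn//.
    by rewrite mulr0 if_same.
  rewrite add0r addr0; transitivity (\sum_(0 + k <= p < n) G p) => //.
  rewrite big_addn big_mkord.
  apply: eq_bigr => r _; rewrite !mxE zZ /G /F.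
  rewrite (_ : (r <= j <= k + r)%N = (j <= r + k <= j + k)%N); last first.
    by rewrite leq_add2r addnC andbC.
  by rewrite [(k + r)%N]addnC; case: ifP => // _; rewrite mul0r.
rewrite sum_window//; last by lia.
rewrite iter_bdiffE mulr_sumr (reindex_inj rev_ord_inj) /=.
apply: eq_bigr => -[l lk] _ /=; rewrite /F subSS.
have {}lk : (l <= k)%N by rewrite -ltnS.
rewrite addKn bin_sub// -signr_odd oddB// signr_addb !signr_odd.
by rewrite (_ : ((j + (k - l)).+1 = (j + k).+1 - l)%N) ?mulrA//; lia.
Qed.

End DifferenceOperator.

Section GreenFunctions.
Context {R : realType}.

(** The mass sits at 1 because differences at 0 are truncated. *)
Definition unit_mass (x : nat) : R := (x == 1)%:R.

(** The fundamental solution of the k-th difference, a shifted binomial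
    coefficient of degree m - 1. *)
Definition cpow m : nat -> R := isum m unit_mass.

Lemma cpow0 m : cpow m 0 = 0.
Proof. exact: isum0. Qed.

Lemma iter_bdiff_cpow m x : iter m bdiff (cpow m) x = unit_mass x.
Proof.
elim: m x => //= m IHm x; rewrite -iterS iterSr -IHm.
by apply: eq_iter_bdiff => y; exact: bdiff_isum.
Qed.

Lemma cpow_ge0 m x : 0 <= cpow m x.
Proof.
elim: m x => [|m IHm] x; first exact: ler0n.
by apply: sumr_ge0 => y _; exact: IHm.
Qed.

Lemma cpow_ub m x : cpow m.+1 x <= x%:R ^+ m.
Proof.
elim: m x => [|m IHm] x.
  rewrite expr0 /cpow /=; case: x => [|x]; first by rewrite big_geq.
  rewrite big_ltn// /unit_mass eqxx big_nat big1 ?addr0// => y /andP[y1 _].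
  by rewrite gtn_eqF.
rewrite /cpow /= -/(cpow m.+1).
apply: (@le_trans _ _ (\sum_(1 <= y < x.+1) x%:R ^+ m)).
  rewrite !big_nat; apply: ler_sum => y /andP[y0 yx].
  by apply: le_trans (IHm y) _; rewrite lerXn2r ?nnegrE// ler_nat -ltnS.
by rewrite sumr_const_nat subn1 /= -[leLHS]mulr_natr -exprSr.
Qed.

Lemma sum_window_le (F : nat -> R) (c : R) a d n : 0 <= c ->
  (forall x, (a <= x < a + d)%N -> F x <= c) ->
  (forall x, ~~ (a <= x < a + d)%N -> F x = 0) ->
  \sum_(0 <= x < n) F x <= d%:R * c.
Proof.
move=> c0 Fc F0.
suff H : \sum_(0 <= x < n) F x <= (minn d (n - a))%:R * c.
  by apply: le_trans H _; rewrite ler_wpM2r// ler_nat geq_minl.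
elim: n => [|n IHn]; first by rewrite big_geq// sub0n minn0 mul0r.
rewrite big_nat_recr//=; have [an|an] := boolP (a <= n < a + d)%N.
  apply: le_trans (lerD IHn (Fc _ an)) _.
  rewrite -[X in _ + X]mul1r -mulrDl ler_wpM2r// natr1 ler_nat.
  by move: an => /andP[]; lia.
rewrite F0// addr0; apply: le_trans IHn _; rewrite ler_wpM2r// ler_nat.
lia.
Qed.

Variables n k : nat.
Hypothesis k0 : (0 < k)%N.
Hypothesis kn : (k <= n)%N.
Variable S : {set 'I_(n - k)}.
Local Notation D := (diff_op R n k).

(** The rows whose window of columns [r, k + r] reaches both sides of a knot.
    Without them the operator splits into independent blocks, one for each gap. *)
Definition enlarged : {set 'I_(n - k)} :=
  [set r : 'I_(n - k) | [exists t in S, (t <= r < t + k)%N]].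

(** No block boundary lies between the columns a and b. *)
Definition noknot (a b : nat) : bool :=
  [forall t in S, ~~ (a < k + t <= b)%N].

Lemma noknot_window (r : 'I_(n - k)) : r \notin enlarged -> noknot r (k + r).
Proof.
rewrite inE negb_exists => /forallP H; apply/forall_inP => t tS.
by have := H t; rewrite tS /=; lia.
Qed.

Lemma noknot_cat a b c : (a <= b)%N -> (b <= c)%N ->
  noknot a c = noknot a b && noknot b c.
Proof.
move=> ab bc; apply/forall_inP/andP => [H|[/forall_inP H1 /forall_inP H2] t tS].
  by split; apply/forall_inP => t tS; have := H t tS; lia.
by have := H1 t tS; have := H2 t tS; lia.
Qed.

Lemma dotv_sumE (f : nat -> R) :
  dotv (\col_(j < n) f j) (\col_(j < n) f j) = \sum_(0 <= x < n) f x ^+ 2.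
Proof.
by rewrite big_mkord; apply: eq_bigr => j _; rewrite !mxE expr2.
Qed.

Lemma cpow_sq_le d y : (y <= d)%N -> cpow k y ^+ 2 <= d%:R ^+ (2 * (k - 1)).
Proof.
move=> yd; have kE : k = (k - 1).+1 by lia.
rewrite mulnC exprM lerXn2r ?nnegrE ?cpow_ge0 ?exprn_ge0//.
rewrite {1}kE; apply: le_trans (cpow_ub _ _) _.
by rewrite lerXn2r ?nnegrE// ler_nat.
Qed.

(** The fundamental solution started at the row r and cut off at the next knot.
    The cut-off is invisible to the rows outside the enlarged set, since no window
    of theirs crosses a knot. *)
Lemma green_right (r : 'I_(n - k)) d : r \notin enlarged ->
  (exists2 t, t \in S & (t = r + d :> nat)%N) \/ (k + r + d = n)%N ->
  exists phi : 'cV[R]_n,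
    (forall r', r' \notin enlarged -> (D *m phi) r' 0 = (r' == r)%:R) /\
    dotv phi phi <= d%:R ^+ (2 * k - 1).
Proof.
move=> rS hd; pose i := (k + r)%N.
pose f x : R := (noknot i x)%:R * cpow k (x.+1 - i)%N.
exists (\col_(j < n) f j); split=> [r' r'S|].
  rewrite (@diff_op_mulE _ _ _ kn _ f); last by move=> j; rewrite mxE.
  have i0 : (0 < i)%N by rewrite addn_gt0 k0.
  pose io : R := (noknot i (k + r'))%:R.
  rewrite (@eq_iter_bdiff_in _ k f (fun x => io * cpow k (x - i.-1)%N)); last first.
    move=> x; rewrite addKn => /andP[r'x xr'].
    rewrite /f (_ : (x.+1 - i = x - i.-1)%N); last by lia.
    have [ix|xi] := leqP i x; last by rewrite (_ : (x - i.-1 = 0)%N) ?cpow0 ?mulr0//; lia.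
    congr (_%:R * _); have := noknot_window r'S.
    rewrite (noknot_cat r'x xr') => /andP[_ nx].
    by rewrite (noknot_cat ix xr') nx andbT.
  rewrite iter_bdiffZ iter_bdiff_shift iter_bdiff_cpow /unit_mass /io /i.
  have [->|r'r] := eqVneq r' r.
    rewrite (_ : (k + r - (k + r).-1 = 1)%N) ?mulr1; last by lia.
    rewrite (_ : noknot _ _)//; apply/forall_inP => t _; lia.
  rewrite (_ : (k + r' - (k + r).-1 == 1)%N = false) ?mulr0//.
  by apply/negP => /eqP h; case/eqP: r'r; apply: val_inj => /=; lia.
rewrite dotv_sumE.
rewrite (_ : d%:R ^+ _ = d%:R * d%:R ^+ (2 * (k - 1)) :> R); last first.
  by rewrite -exprS; congr (_ ^+ _); lia.
have bnd x : (f x != 0) && (x < n)%N -> (i <= x < i + d)%N.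
  move=> /andP[fx0 xn]; apply/andP; split.
    rewrite leqNgt; apply: contra fx0 => xi.
    by rewrite /f (_ : (x.+1 - i = 0)%N) ?cpow0 ?mulr0//; lia.
  case: hd => [[t tS td]|hd]; last by rewrite /i; lia.
  rewrite ltnNge; apply: contra fx0 => h.
  rewrite /f (_ : noknot i x = false) ?mul0r//.
  apply/negP => /forall_inP /(_ t tS); rewrite td.
  have d0 : (0 < d)%N.
    rewrite lt0n; apply: contra rS => /eqP d0; rewrite inE; apply/existsP.
    by exists t; rewrite tS /= td d0 addn0 leqnn /= -addn1 leq_add2l.
  by move: h; rewrite /i; lia.
rewrite big_nat (eq_bigr (fun x => if (x < n)%N then f x ^+ 2 else 0)); last first.
  by move=> x /andP[_ ->].
rewrite -big_nat; apply: (sum_window_le (a := i)).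
- by rewrite exprn_ge0.
- move=> x /andP[ix xd]; case: ifP => _; last by rewrite exprn_ge0.
  rewrite /f exprMn; case: noknot; rewrite ?expr1n ?mul1r ?expr0n ?mul0r ?exprn_ge0//.
  by apply: cpow_sq_le; lia.
- move=> x xd; case: ifP => // xn; apply/eqP; rewrite expf_eq0 /=.
  by apply: contraR xd => fx0; apply: bnd; rewrite fx0.
Qed.

(** The mirror image: the fundamental solution running leftwards from the row r and
    cut off at the previous knot. It differs from the rightward one by an element
    of the kernel of the remaining rows, and is the shorter one when the previous
    knot is closer. *)
Lemma green_left (r : 'I_(n - k)) d : r \notin enlarged ->
  (exists2 t, t \in S & (t + d = r :> nat)%N) \/ (d = r.+1)%N ->
  exists phi : 'cV[R]_n,
    (forall r', r' \notin enlarged -> (D *m phi) r' 0 = (r' == r)%:R) /\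
    dotv phi phi <= d%:R ^+ (2 * k - 1).
Proof.
move=> rS hd; pose i := (k + r)%N.
pose f x : R := (-1) ^+ k * ((noknot x i)%:R * cpow k (r.+1 - x)%N).
exists (\col_(j < n) f j); split=> [r' r'S|].
  rewrite (@diff_op_mulE _ _ _ kn _ f); last by move=> j; rewrite mxE.
  pose io : R := (noknot r' i)%:R.
  rewrite (@eq_iter_bdiff_in _ k f (fun x => ((-1) ^+ k * io) * cpow k (r.+1 - x)%N)); last first.
    move=> x; rewrite addKn => /andP[r'x xr'].
    rewrite /f -mulrA; congr (_ * _).
    have [xr|rx] := leqP x r; last by rewrite (_ : (r.+1 - x = 0)%N) ?cpow0 ?mulr0//; lia.
    congr (_%:R * _); have := noknot_window r'S.
    rewrite (noknot_cat r'x xr') => /andP[nx _].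
    have xi : (x <= i)%N by rewrite /i; lia.
    by rewrite (noknot_cat r'x xi) nx.
  rewrite iter_bdiffZ [(k + r')%N]addnC iter_bdiff_rev iter_bdiff_cpow /unit_mass.
  rewrite mulrACA -expr2 -exprM mulnC exprM sqrrN expr1n expr1n mul1r /io.
  have [->|r'r] := eqVneq r' r.
    rewrite subSnn eqxx mulr1 /i (_ : noknot _ _)//; exact: noknot_window.
  rewrite (_ : (r.+1 - r' == 1)%N = false) ?mulr0//.
  by apply/negP => /eqP h; case/eqP: r'r; apply: val_inj => /=; lia.
rewrite dotv_sumE.
rewrite (_ : d%:R ^+ _ = d%:R * d%:R ^+ (2 * (k - 1)) :> R); last first.
  by rewrite -exprS; congr (_ ^+ _); lia.
have bnd x : f x != 0 -> (r.+1 - d <= x < r.+1 - d + d)%N.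
  move=> fx0.
  have xr : (x <= r)%N.
    rewrite leqNgt; apply: contra fx0 => xi.
    by rewrite /f (_ : (r.+1 - x = 0)%N) ?cpow0 ?mulr0//; lia.
  case: hd => [[t tS td]|hd]; last by lia.
  apply/andP; split; last by lia.
  rewrite leqNgt; apply: contra fx0 => h.
  rewrite /f (_ : noknot x i = false) ?mul0r ?mulr0//.
  by apply/negP => /forall_inP /(_ t tS); rewrite /i; lia.
apply: (sum_window_le (a := r.+1 - d)).
- by rewrite exprn_ge0.
- move=> x /andP[ix xd]; rewrite /f exprMn -exprM mulnC exprM sqrrN expr1n expr1n mul1r exprMn.
  case: noknot; rewrite ?expr1n ?mul1r ?expr0n ?mul0r ?exprn_ge0//.
  by apply: cpow_sq_le; lia.
- move=> x xd; apply/eqP; rewrite expf_eq0 /=.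
  by apply: contraR xd => fx0; apply: bnd; rewrite fx0.
Qed.

End GreenFunctions.

(** * Projection on the kernel *)

Section OrthogonalProjection.
Context {R : realType} {n : nat}.
Implicit Types (us vs : seq 'cV[R]_n) (x y u v : 'cV[R]_n).

Definition oproj us x : 'cV[R]_n := \sum_(u <- us) dotv u x *: u.

Lemma oprojD us x y : oproj us (x + y) = oproj us x + oproj us y.
Proof. by rewrite -big_split; apply: eq_bigr => u _; rewrite dotvDr scalerDl. Qed.

Lemma oprojZ us a x : oproj us (a *: x) = a *: oproj us x.
Proof. by rewrite scaler_sumr; apply: eq_bigr => u _; rewrite dotvZr scalerA. Qed.

Lemma oprojB us x y : oproj us (x - y) = oproj us x - oproj us y.
Proof. by rewrite -scaleN1r oprojD oprojZ scaleN1r. Qed.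

Lemma oproj0 us : oproj us 0 = 0.
Proof. by rewrite -(scale0r 0) oprojZ !scale0r. Qed.

Lemma oproj_sum us (I : Type) (s : seq I) (P : pred I) (F : I -> 'cV[R]_n) :
  oproj us (\sum_(i <- s | P i) F i) = \sum_(i <- s | P i) oproj us (F i).
Proof.
by elim/big_rec2: _ => [|i a b _ <-]; rewrite ?oproj0// oprojD.
Qed.

Lemma dotv_oproj us x y : dotv (oproj us x) y = \sum_(u <- us) dotv u x * dotv u y.
Proof. by rewrite dotv_suml; apply: eq_bigr => u _; rewrite dotvZl. Qed.

Lemma dotv_oprojC us x y : dotv (oproj us x) y = dotv x (oproj us y).
Proof.
rewrite [RHS]dotvC !dotv_oproj; apply: eq_bigr => u _; exact: mulrC.
Qed.

Lemma orthonormal_cons u us : orthonormal_seq us -> dotv u u = 1 ->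
  (forall v, v \in us -> dotv u v = 0) -> orthonormal_seq (u :: us).
Proof.
move=> on uu uv [|i] [|j] //= hi hj.
- by rewrite uv// mem_nth.
- by rewrite dotvC uv// mem_nth.
- by rewrite on.
Qed.

Lemma oproj_basis us i : orthonormal_seq us -> (i < size us)%N ->
  oproj us us`_i = us`_i.
Proof.
move=> on ius; rewrite /oproj (big_nth 0) big_mkord.
rewrite (bigD1 (Ordinal ius))//= on// eqxx scale1r big1 ?addr0// => j ji.
by rewrite on// (_ : (j == i :> nat) = false) ?scale0r//; exact: negbTE ji.
Qed.

Lemma oproj_mem us u : orthonormal_seq us -> u \in us -> oproj us u = u.
Proof.
by move=> on uus; rewrite -(nth_index 0 uus) oproj_basis// index_mem.
Qed.

Lemma oproj_idem us x : orthonormal_seq us -> oproj us (oproj us x) = oproj us x.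
Proof.
move=> on; rewrite {1}[oproj us x]/oproj oproj_sum [RHS]/oproj !big_seq.
apply: eq_bigr => u uus.
by rewrite oprojZ oproj_mem.
Qed.

Lemma norm2_oproj us x : orthonormal_seq us ->
  norm2 (oproj us x) ^+ 2 = \sum_(u <- us) dotv u x ^+ 2.
Proof.
move=> on; rewrite norm2_sqr dotv_oprojC oproj_idem// dotvC dotv_oproj.
by apply: eq_bigr => u _; rewrite expr2.
Qed.

Lemma norm2_oprojC_le us x : orthonormal_seq us -> norm2 (x - oproj us x) <= norm2 x.
Proof.
move=> on; rewrite /norm2 ler_wsqrtr// dotvBl !dotvBr.
rewrite -[dotv (oproj us x) (oproj us x)]dotv_oprojC oproj_idem//.
rewrite (dotv_oprojC us x x) subrr subr0 -dotv_oprojC.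
by rewrite lerBlDr lerDl dotv_oproj sumr_ge0// => u _; rewrite -expr2 sqr_ge0.
Qed.

Lemma gram_schmidt vs : exists us, [/\ orthonormal_seq us, (size us <= size vs)%N &
  forall v, v \in vs -> oproj us v = v].
Proof.
elim: vs => [|v vs [us [on sz H]]]; first by exists [::].
pose w := v - oproj us v.
have wus u : u \in us -> dotv w u = 0.
  by move=> uus; rewrite dotvBl dotv_oprojC oproj_mem// subrr.
have [w0|w0] := eqVneq w 0.
  exists us; split=> //; first exact: leqW.
  move=> x; rewrite inE => /predU1P[->|/H//].
  by apply/eqP; rewrite eq_sym -subr_eq0; exact/eqP.
have nw0 : norm2 w != 0.
  by apply: contra w0 => /eqP nw; rewrite (@dotv_eq0 _ _ w)// -norm2_sqr nw expr0n.
pose u := (norm2 w)^-1 *: w.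
have uu : dotv u u = 1.
  by rewrite dotvZl dotvZr -norm2_sqr expr2 mulKf// mulVf.
exists (u :: us); split.
- by apply: orthonormal_cons => // x xus; rewrite dotvZl wus// mulr0.
- by [].
have consE x : oproj (u :: us) x = dotv u x *: u + oproj us x.
  by rewrite /oproj big_cons.
have uproj x : dotv u (oproj us x) = 0.
  by rewrite dotv_sumr big_seq big1// => z zus; rewrite dotvZr dotvZl wus// !mulr0.
move=> x; rewrite inE => /predU1P[->|xvs]; rewrite consE.
  have vE : v = w + oproj us v by rewrite subrK.
  rewrite {1}vE dotvDr uproj addr0 dotvZl -norm2_sqr expr2 mulKf//.
  by rewrite scalerA divff// scale1r -vE.
by rewrite -{1}(H _ xvs) uproj scale0r add0r H.
Qed.

End OrthogonalProjection.

Section KernelDimension.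
Context {R : realType}.
Variables n k : nat.
Hypothesis k0 : (0 < k)%N.
Hypothesis kn : (k <= n)%N.
Local Notation D := (diff_op R n k).

(** The Green functions for the empty set of knots are the columns of a right
    inverse. *)
Lemma diff_op_row_free : row_free D.
Proof.
have H (r : 'I_(n - k)) : exists phi : 'cV[R]_n,
    forall r', (D *m phi) r' 0 = (r' == r)%:R.
  have notin r' : r' \notin enlarged (finset.set0 : {set 'I_(n - k)}).
    by rewrite inE; apply/existsP => -[t]; rewrite inE.
  have [|phi [H _]] := @green_right R n k k0 kn finset.set0 r (n - k - r) (notin r).
    by right; have := ltn_ord r; lia.
  by exists phi => r'; apply: H.
have [phi phiP] := choice H.
apply/row_freeP; exists (\matrix_(j, r) phi r j 0).
apply/matrixP => r' r; rewrite [RHS]mxE -phiP !mxE.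
by apply: eq_bigr => j _; rewrite [X in _ * X]mxE.
Qed.

Variable S : {set 'I_(n - k)}.

(** Every knot contributes at most k rows. *)
Lemma card_enlarged : (#|enlarged S| <= k * #|S|)%N.
Proof.
have cnt a N : (\sum_(0 <= r < N) (a <= r < a + k)%N <= minn k (N - a))%N.
  elim: N => [|N IHN]; first by rewrite big_geq.
  by rewrite big_nat_recr//=; move: IHN; case: (boolP (a <= N < a + k)%N) => /=; lia.
rewrite mulnC -sum_nat_const -sum1_card big_mkcond /=.
apply: (@leq_trans (\sum_(r < n - k) \sum_(t in S) (t <= r < t + k)%N)).
  apply: leq_sum => r _; case: ifP => //; rewrite inE => /existsP[t /andP[tS h]].
  by rewrite (bigD1 t)//= h.
rewrite exchange_big /=; apply: leq_sum => t tS.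
rewrite -(big_mkord xpredT (fun r => (t <= r < t + k)%N : nat)).
by apply: leq_trans (cnt _ _) _; exact: geq_minl.
Qed.

(** Deleting the rows of the enlarged set lowers the full row rank n - k by at most
    k s, so that the kernel of the remaining rows has dimension at most
    n - (n - k - k s) = k (s + 1). *)
Lemma kernel_basis : exists us : seq 'cV[R]_n,
  [/\ orthonormal_seq us, (size us <= k * #|S|.+1)%N &
      forall h, (forall r, r \notin enlarged S -> (D *m h) r 0 = 0) ->
        oproj us h = h].
Proof.
pose A : 'M[R]_(n - k, n) :=
  \matrix_(r, j) if r \in enlarged S then 0 else D r j.
pose B := \sum_(r in enlarged S) (delta_mx r 0 : 'cV[R]_(n - k)) *m row r D.
have DE : D = A + B.
  rewrite /A /B; move: (diff_op R n k) => M; apply/matrixP => r j.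
  rewrite !mxE summxE; case: ifP => rS.
    rewrite add0r (bigD1 r)//= big1 ?addr0 => [|i /andP[iS ir]].
      by rewrite !mxE big_ord1 !mxE !eqxx mul1r.
    by rewrite !mxE big_ord1 !mxE eq_sym (negbTE ir) mul0r.
  rewrite big1 ?addr0// => i iS; rewrite !mxE big_ord1 !mxE.
  rewrite (_ : (r == i) = false) ?mul0r//.
  by apply: contraFF rS => /eqP ->.
have rB : (\rank B <= #|enlarged S|)%N.
  rewrite -sum1_card /B; elim/big_ind2: _ => [|a m1 b m2 h1 h2|r _].
  - by rewrite mxrank0.
  - by apply: leq_trans (mxrank_add _ _) _; exact: leq_add.
  - by apply: leq_trans (mxrankM_maxl _ _) _; exact: rank_leq_col.
have rA : (n - k <= \rank A + #|enlarged S|)%N.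
  have := diff_op_row_free; rewrite /row_free {1}DE => /eqP rD.
  rewrite -[leqLHS]rD.
  by apply: leq_trans (mxrank_add _ _) _; rewrite leq_add2l.
pose K := row_base (kermx A^T).
pose vs := [seq (row i K)^T | i <- enum 'I_(\rank (kermx A^T))].
have [us [on sz Hus]] := gram_schmidt vs; exists us; split=> //.
  apply: leq_trans sz _; rewrite size_map size_enum_ord mxrank_ker mxrank_tr.
  by have := card_enlarged; rewrite mulnS; lia.
move=> h Dh.
have hA : h^T *m A^T = 0.
  rewrite -trmx_mul; apply/trmx_inj; rewrite trmxK trmx0.
  apply/colP => r; rewrite [RHS]mxE.
  have [rS|rS] := boolP (r \in enlarged S).
    by rewrite mxE big1// => j _; rewrite mxE rS mul0r.
  rewrite -(Dh r rS) !mxE; apply: eq_bigr => j _.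
  by rewrite [A r j]mxE (negbTE rS).
have /submxP[c hc] : (h^T <= K)%MS by rewrite eq_row_base; apply/sub_kermxP.
have -> : h = \sum_i c 0 i *: (row i K)^T.
  apply: trmx_inj; rewrite hc mulmx_sum_row raddf_sum /=.
  by apply: eq_bigr => i _; rewrite linearZ /= trmxK.
rewrite oproj_sum; apply: eq_bigr => i _; rewrite oprojZ Hus//.
by apply/mapP; exists i => //; rewrite mem_enum.
Qed.

End KernelDimension.

(** * Oracle inequality for fixed noise *)

Section DeterministicInequalities.
Context {R : realType}.
Variables n k : nat.
Hypothesis n0 : (0 < n)%N.
Local Notation D := (diff_op R n k).

Let n0R : (0 : R) < n%:R. Proof. by rewrite ltr0n. Qed.

Lemma sqnormnE (v : 'cV[R]_n) : sqnormn v = n%:R^-1 * dotv v v.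
Proof. by congr (_ * _); apply: eq_bigr => i _; rewrite expr2. Qed.

Lemma sqnormn_ge0 (v : 'cV[R]_n) : 0 <= sqnormn v.
Proof. by rewrite sqnormnE mulr_ge0 ?invr_ge0 ?dotv_ge0. Qed.

Lemma norm1_convex m (t : R) (a b : 'cV[R]_m) : 0 <= t <= 1 ->
  norm1 ((1 - t) *: a + t *: b) <= (1 - t) * norm1 a + t * norm1 b.
Proof.
move=> /andP[t0 t1]; rewrite /norm1 !mulr_sumr -big_split /=.
apply: ler_sum => i _; rewrite !mxE; apply: le_trans (ler_normD _ _) _.
by rewrite !normrM (ger0_norm t0) [`|1 - t|]ger0_norm ?subr_ge0.
Qed.

(** The quadratic part of the objective is strongly convex: compare the minimizer
    with the point at a fraction t of the way to g, divide by t and let t tend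
    to 0. *)
Lemma tf_strong_min (lambda : R) (y fh g : 'cV[R]_n) : 0 <= lambda ->
  is_tf_estimate k lambda y fh ->
  tf_objective k lambda y fh + sqnormn (fh - g) <= tf_objective k lambda y g.
Proof.
move=> l0 fhP.
have H t : 0 < t < 1 ->
    tf_objective k lambda y fh + (1 - t) * sqnormn (fh - g) <= tf_objective k lambda y g.
  move=> /andP[t0 t1].
  have := fhP ((1 - t) *: fh + t *: g); rewrite /tf_objective.
  have -> : D *m ((1 - t) *: fh + t *: g) = (1 - t) *: (D *m fh) + t *: (D *m g).
    by rewrite mulmxDr !scalemxAr.
  have h1 : norm1 ((1 - t) *: (D *m fh) + t *: (D *m g)) <=
      (1 - t) * norm1 (D *m fh) + t * norm1 (D *m g).
    by apply: norm1_convex; rewrite !ltW.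
  have h2 := ler_wpM2l l0 h1.
  have -> : sqnormn (y - ((1 - t) *: fh + t *: g)) = (1 - t) * sqnormn (y - fh)
      + t * sqnormn (y - g) - t * (1 - t) * sqnormn (fh - g).
    have -> : y - ((1 - t) *: fh + t *: g) = (y - fh) + t *: (fh - g).
      by apply/colP => i; rewrite !mxE; ring.
    have -> : y - g = (y - fh) + (fh - g) by rewrite addrA subrK.
    move: (y - fh) (fh - g) => a b.
    by rewrite !sqnormnE !(dotvDl, dotvDr, dotvZl, dotvZr) (dotvC b a); ring.
  move=> h3; rewrite -(ler_pM2l t0); move: h2 h3.
  move: (norm1 _) (norm1 _) (norm1 _) (sqnormn _) (sqnormn _) (sqnormn _).
  move=> a b c d e f h2 h3; lra.
set s := sqnormn (fh - g) in H *.
have s0 : 0 <= s by exact: sqnormn_ge0.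
apply/ler_addgt0Pr => e e0.
have se0 : 0 < s + e + e by lra.
have := H (e / (s + e + e)); rewrite divr_gt0// ltr_pdivrMr// mul1r => /(_ ltac:(lra)).
suff : e / (s + e + e) * s <= e by lra.
by rewrite mulrAC ler_pdivrMr// ler_pM2l//; lra.
Qed.

(** Add the strong minimality inequalities of the two estimates, each tested
    against the other one. *)
Lemma tf_lipschitz (lambda : R) (y y' fh fh' : 'cV[R]_n) : 0 <= lambda ->
  is_tf_estimate k lambda y fh -> is_tf_estimate k lambda y' fh' ->
  norm2 (fh - fh') <= norm2 (y - y').
Proof.
move=> l0 /(tf_strong_min fh' l0) h1 /(tf_strong_min fh l0) h2.
have h3 : dotv (fh - fh') (fh - fh') <= dotv (y - y') (fh - fh').
  move: h1 h2; rewrite /tf_objective.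
  have -> : fh' - fh = - (fh - fh') by rewrite opprB.
  set L := 2 * lambda * norm1 (D *m fh); set L' := 2 * lambda * norm1 (D *m fh').
  rewrite -(ler_pM2l n0R) => h1; rewrite -(ler_pM2l n0R) => h2.
  move: h1 h2; rewrite !mulrDr !sqnormnE !mulrA !mulfV ?gt_eqF// !mul1r.
  rewrite !(dotvBl, dotvBr, dotvNl) !(dotvC _ (- _)) !(dotvBl, dotvNl, dotvBr).
  rewrite (dotvC fh y) (dotvC fh' y) (dotvC fh' y') (dotvC fh y') (dotvC fh' fh).
  lra.
have [d0|d0] := eqVneq (norm2 (fh - fh')) 0; first by rewrite d0 norm2_ge0.
have d1 : 0 < norm2 (fh - fh') by rewrite lt0r d0 norm2_ge0.
rewrite -(ler_pM2r d1) -expr2 norm2_sqr.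
by apply: le_trans h3 _; exact: cauchy_schwarz.
Qed.

Lemma dotv_mulmx m (M : 'M[R]_(m, n)) (z : 'cV[R]_m) (h : 'cV[R]_n) :
  dotv z (M *m h) = dotv (M^T *m z) h.
Proof.
rewrite /dotv; under eq_bigr do rewrite mxE mulr_sumr.
rewrite exchange_big /=; apply: eq_bigr => j _; rewrite mxE mulr_suml.
by apply: eq_bigr => i _; rewrite mxE; ring.
Qed.

(** With h = fh - f, strong minimality bounds the error by the noise term <eps, h>
    and the difference of the penalties. The component of h off the span of us is
    a combination of the projected Green functions with coefficients (D h)_r, so
    the weights w turn the noise into a loss of w_r |(D h)_r| on the rows outside
    E, besides |P eps| |h|. The subgradient z of the penalty pays for this loss,
    because |z_r| <= 1 - w_r there, and what remains is
    - <z, D h> = - <D^T z, h> <= |D^T z| |h|. Finally 2 x |h| - |h|^2 <= x^2. *)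
Lemma oracle_inequality (lambda : R) (f0 f y fh : 'cV[R]_n)
    (S E : {set 'I_(n - k)}) (us : seq 'cV[R]_n)
    (phi : 'I_(n - k) -> 'cV[R]_n) (w : 'I_(n - k) -> R) (z : 'cV[R]_(n - k))
    (A G : R) :
  0 <= lambda -> is_tf_estimate k lambda y fh ->
  S \subset E ->
  (forall h, (forall r, r \notin E -> (D *m h) r 0 = 0) -> oproj us h = h) ->
  (forall r r', r \notin E -> r' \notin E -> (D *m phi r) r' 0 = (r' == r)%:R) ->
  (forall r, r \notin E ->
    `|dotv (phi r - oproj us (phi r)) (y - f0)| <= n%:R * lambda * w r) ->
  (forall r, r \in S -> z r 0 * (D *m f) r 0 = `|(D *m f) r 0|) ->
  (forall r, `|z r 0| <= 1) ->
  (forall r, r \notin E -> `|z r 0| <= 1 - w r) ->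
  norm2 (oproj us (y - f0)) <= A -> norm2 (D^T *m z) <= G ->
  sqnormn (fh - f0) <= sqnormn (f - f0) + 4 * lambda * norm1_off S (D *m f)
    + (A / Num.sqrt n%:R + lambda * (Num.sqrt n%:R * G)) ^+ 2.
Proof.
move=> l0 fhP SE Hus Hphi Hw zS z1 zw HA HG.
set h := fh - f; set eps := y - f0.
pose b r := (D *m h) r 0.
have E1 : sqnormn (fh - f0) <= sqnormn (f - f0) + 2 * (n%:R^-1 * dotv eps h)
    - n%:R^-1 * dotv h h + 2 * lambda * (norm1 (D *m f) - norm1 (D *m fh)).
  have := tf_strong_min f l0 fhP; rewrite /tf_objective.
  have -> : y - fh = eps - (h + (f - f0)).
    by apply/colP => i; rewrite !mxE; ring.
  have -> : y - f = eps - (f - f0) by apply/colP => i; rewrite !mxE; ring.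
  have -> : fh - f0 = h + (f - f0) by apply/colP => i; rewrite !mxE; ring.
  rewrite -/h; move: (f - f0) => e; generalize h eps => x t.
  rewrite !sqnormnE !(dotvBl, dotvBr, dotvDl, dotvDr) (dotvC x t) (dotvC e t).
  rewrite (dotvC e x).
  lra.
have E2 : norm1 (D *m f) - norm1 (D *m fh) <= 2 * norm1_off S (D *m f)
    - \sum_(r in S) z r 0 * b r - \sum_(r | r \notin S) `|b r|.
  rewrite /norm1 /norm1_off !mulr_sumr.
  rewrite (bigID (mem S)) [X in _ - X](bigID (mem S)) /= opprD addrACA -!sumrB.
  have fhE r : (D *m fh) r 0 = (D *m f) r 0 + b r.
    by rewrite /b /h mulmxBr !mxE; ring.
  rewrite [leRHS]addrAC [leRHS]addrC; apply: lerD.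
    rewrite -sumrN; apply: ler_sum => r rS; rewrite fhE -(zS r rS).
    have : z r 0 * ((D *m f) r 0 + b r) <= `|(D *m f) r 0 + b r|.
      apply: le_trans (ler_norm _) _; rewrite normrM -[leRHS]mul1r.
      by rewrite ler_wpM2r.
    by rewrite mulrDr; lra.
  rewrite -sumrB; apply: ler_sum => r rS; rewrite fhE.
  have : `|b r| <= `|(D *m f) r 0 + b r| + `|(D *m f) r 0|.
    apply: le_trans (ler_normB _ _); rewrite addrAC subrr add0r//.
  lra.
have E3 : dotv eps h = dotv (oproj us eps) h +
    \sum_(r | r \notin E) b r * dotv (phi r - oproj us (phi r)) eps.
  pose g := \sum_(r | r \notin E) b r *: phi r.
  have gE : oproj us (h - g) = h - g.
    apply: Hus => r rE.
    have DZ r' : (D *m (b r' *: phi r')) r 0 = b r' * (D *m phi r') r 0.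
      by rewrite -scalemxAr mxE.
    rewrite mulmxBr mulmx_sumr mxE.
    rewrite [X in _ + X]mxE summxE (bigD1 r)//= big1 ?addr0 => [|r' /andP[r'E r'r]].
      by rewrite DZ Hphi// eqxx mulr1 subrr.
    by rewrite DZ Hphi// eq_sym (negbTE r'r) mulr0.
  have hE : h - oproj us h = g - oproj us g.
    have -> : oproj us h = h - g + oproj us g.
      by apply/eqP; rewrite -subr_eq -oprojB gE.
    by rewrite opprD addrA opprB subrKC.
  rewrite dotv_oprojC -[X in dotv eps X](subrK (oproj us h)) hE dotvDr addrC.
  congr (_ + _); rewrite dotvC /g oproj_sum -sumrB dotv_suml.
  by apply: eq_bigr => r _; rewrite oprojZ -scalerBr dotvZl.
have E4 : n%:R^-1 * dotv eps h <= n%:R^-1 * (A * norm2 h) +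
    lambda * \sum_(r | r \notin E) w r * `|b r|.
  rewrite E3 mulrDr; apply: lerD.
    rewrite ler_pM2l ?invr_gt0//; apply: le_trans (cauchy_schwarz _ _) _.
    by rewrite ler_wpM2r ?norm2_ge0.
  rewrite mulrC ler_pdivrMr// [leRHS]mulrC mulrA mulr_sumr.
  apply: ler_sum => r rE; apply: le_trans (ler_norm _) _.
  have := ler_wpM2r (normr_ge0 (b r)) (Hw r rE).
  by rewrite normrM [`|b r| * _]mulrC mulrA.
(* The weights and the margins of z cancel row by row. *)
have E5 : \sum_(r | r \notin E) w r * `|b r| - \sum_(r in S) z r 0 * b r
    - \sum_(r | r \notin S) `|b r| <= G * norm2 h.
  have : - dotv z (D *m h) <= G * norm2 h.
    rewrite dotv_mulmx -dotvNl; apply: le_trans (cauchy_schwarz _ _) _.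
    have -> : norm2 (- (D^T *m z)) = norm2 (D^T *m z).
      by rewrite /norm2 dotvNl dotvC dotvNl opprK.
    by rewrite ler_wpM2r ?norm2_ge0.
  apply: le_trans.
  have -> : dotv z (D *m h) = \sum_(r in S) z r 0 * b r
      + \sum_(r | r \notin S) z r 0 * b r by rewrite /dotv (bigID (mem S)).
  rewrite opprD [leLHS]addrAC [leRHS]addrC lerD2r.
  rewrite (_ : \sum_(r | r \notin E) _ =
    \sum_(r | r \notin S) if r \notin E then w r * `|b r| else 0); last first.
    rewrite -big_mkcondr; apply: eq_bigl => r.
    by case: (boolP (r \in S)) => //= rS; rewrite (fintype.subsetP SE).
  rewrite -sumrB -sumrN; apply: ler_sum => r rS.
  have zb : - (z r 0 * b r) >= - (`|z r 0| * `|b r|).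
    by rewrite lerN2 -normrM ler_norm.
  have b0 : 0 <= `|b r| by [].
  case: ifPn => rE.
    have := ler_wpM2r b0 (zw r rE); rewrite mulrBl mul1r; lra.
  have := ler_wpM2r b0 (z1 r); rewrite mul1r; lra.
have E6 := ler_wpM2l l0 E5.
have E7 := ler_wpM2l l0 E2.
have hh : dotv h h = norm2 h ^+ 2 by rewrite norm2_sqr.
rewrite hh in E1.
have sn0 : 0 < Num.sqrt (n%:R : R) by rewrite sqrtr_gt0.
have E8 : 2 * (n%:R^-1 * (A * norm2 h)) + 2 * lambda * (G * norm2 h)
    - n%:R^-1 * norm2 h ^+ 2 <=
    (A / Num.sqrt n%:R + lambda * (Num.sqrt n%:R * G)) ^+ 2.
  set q := Num.sqrt n%:R in sn0 *.
  have -> : n%:R = q ^+ 2 :> R by rewrite sqr_sqrtr// ltW.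
  have -> : 2 * ((q ^+ 2)^-1 * (A * norm2 h)) + 2 * lambda * (G * norm2 h)
    - (q ^+ 2)^-1 * norm2 h ^+ 2 =
    (A / q + lambda * (q * G)) ^+ 2 -
    (A / q + lambda * (q * G) - norm2 h / q) ^+ 2.
    by field; rewrite gt_eqF.
  by rewrite lerBlDr lerDl sqr_ge0.
apply: le_trans E1 _; move: E4 E6 E7 E8; move: (norm1_off _ _) (norm1 _) (norm1 _).
move: (\sum_(r | r \notin E) _) (\sum_(r in S) _) (\sum_(r | r \notin S) _).
move: (n%:R^-1 * dotv eps h) (n%:R^-1 * (A * norm2 h)) (G * norm2 h).
move: (n%:R^-1 * norm2 h ^+ 2) (_ ^+ 2) (sqnormn _).
move=> a1 a2 a3 a4 a5 a6 a7 a8 a9 a10 a11 a12; lra.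
Qed.

End DeterministicInequalities.

(** * Knots and measurability *)

Section Knots.
Variables n k : nat.
Hypothesis kn : (k < n)%N.
Variable S : {set 'I_(n - k)}.

Let kpos := [seq (k + nat_of_ord r).+1 | r <- enum S].

Lemma size_knots : size (k :: kpos) = #|S|.+1.
Proof. by rewrite /= size_map -cardE. Qed.

Lemma sorted_knots : sorted ltn (k :: kpos).
Proof.
have H : sorted ltn kpos.
  rewrite /kpos sorted_map; apply: sub_sorted (_ : sorted (relpre val ltn) _).
    by move=> i j /=; rewrite ltnS ltn_add2l.
  rewrite {1}/(enum _) /=; apply: sorted_filter.
    by move=> i j l; exact: ltn_trans.
  by rewrite -enumT -sorted_map val_enum_ord iota_ltn_sorted.
rewrite /= path_min_sorted//; apply/allP => x /mapP[r _ ->] /=.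
by rewrite ltnS leq_addr.
Qed.

Lemma knots_le x : x \in k :: kpos -> (x <= n)%N.
Proof.
rewrite inE => /predU1P[->|/mapP[r _ ->]]; first exact: ltnW.
by have := ltn_ord r; lia.
Qed.

Lemma knot0 : knot S 0 = k. Proof. by []. Qed.

Lemma knot_last : knot S #|S|.+1 = n.+1.
Proof. by rewrite /knot nth_default// size_knots. Qed.

Lemma knot_lt i : (i <= #|S|)%N -> (knot S i < knot S i.+1)%N.
Proof.
move=> iS; have [iS'|] := ltnP i #|S|.
  by rewrite /knot; apply: (sorted_ltn_nth ltn_trans);
    rewrite ?sorted_knots// inE size_knots !ltnS// ltnW.
move=> Si; have -> : i = #|S| by apply/eqP; rewrite eqn_leq iS.
rewrite knot_last ltnS; apply: knots_le; apply: mem_nth.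
by rewrite size_knots.
Qed.

Lemma knotE r0 i : (0 < i <= #|S|)%N ->
  knot S i = (k + nth r0 (enum S) i.-1).+1 /\ nth r0 (enum S) i.-1 \in S.
Proof.
case: i => // i /= iS; split; last by rewrite -mem_enum mem_nth// -cardE.
by rewrite /knot /= (nth_map r0)// -cardE.
Qed.

Lemma knot_index r : r \in S ->
  exists2 i, (0 < i <= #|S|)%N & nth r (enum S) i.-1 = r.
Proof.
rewrite -mem_enum => rS; exists (index r (enum S)).+1; last by rewrite nth_index.
by rewrite /= cardE index_mem.
Qed.

Lemma knot_between (r : 'I_(n - k)) : exists2 i, (i <= #|S|)%N &
  (knot S i <= (k + r).+1 < knot S i.+1)%N.
Proof.
suff H m : (m <= #|S|.+1)%N -> ((k + r).+1 < knot S m)%N ->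
    exists2 i, (i < m)%N & (knot S i <= (k + r).+1 < knot S i.+1)%N.
  have [|i iS Hi] := H #|S|.+1 (leqnn _); last by exists i.
  by rewrite knot_last; have := ltn_ord r; lia.
elim: m => [|m IHm] mS; first by rewrite knot0; lia.
have [rm _|mr rm] := ltnP (k + r).+1 (knot S m).
  by have [i im Hi] := IHm (ltnW mS) rm; exists i => //; rewrite leqW.
by exists m => //; rewrite mr rm.
Qed.

Lemma knot_between_strict (r : 'I_(n - k)) i : r \notin S -> (i <= #|S|)%N ->
  (knot S i <= (k + r).+1)%N -> (knot S i < (k + r).+1)%N.
Proof.
move=> rS iS; rewrite leq_eqVlt => /predU1P[|//].
case: i iS => [|i] iS; first by rewrite knot0; lia.
have [-> mS] := @knotE r i.+1 iS => -[] /eqP; rewrite eqn_add2l => /eqP/val_inj e.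
by rewrite e (negbTE rS) in mS.
Qed.

Lemma gap_le_max i : (i <= #|S|)%N -> (knot S i.+1 - knot S i <= gap_max S)%N.
Proof.
by move=> iS; apply: (@leq_bigmax_seq _ _ _ (gap S) i.+1); rewrite ?mem_index_iota.
Qed.

End Knots.

Section LipschitzMeasurability.
Context {R : realType} {d : measure_display} {T : measurableType d}.
Variable P : probability T R.
Variables (n : nat) (Y : 'I_n -> {RV P >-> R}).

Lemma norm2_le_sum (x : 'cV[R]_n) : norm2 x <= \sum_i `|x i 0|.
Proof.
have s0 : 0 <= \sum_i `|x i 0| by apply: sumr_ge0.
rewrite -(ler_sqr (norm2_ge0 _) s0) norm2_sqr expr2 mulr_suml.
apply: ler_sum => i _; apply: le_trans (ler_norm _) _; rewrite normrM.
by rewrite ler_wpM2l// (bigD1 i)//= lerDl sumr_ge0.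
Qed.

(** F y < c holds exactly when F q + |y - q|_1 < c for some rational point q, so
    the sublevel sets of F are countable unions of sets that are measurable
    coordinatewise. *)
Lemma measurable_lipschitz (F : 'cV[R]_n -> R) :
  (forall y y', `|F y - F y'| <= norm2 (y - y')) ->
  measurable_fun setT (fun w => F (data_vector Y w)).
Proof.
move=> FL.
have mY (q : 'I_n -> R) : measurable_fun setT (fun w => \sum_i `|Y i w - q i|).
  apply: measurable_sum => i; apply: measurableT_comp => //.
  by apply: measurable_funB => //; exact: measurable_funPT.
apply: (measurability _ (RGenInftyO.measurableE R)) => //.
move=> _ [_ [c ->] <-]; rewrite setTI.
pose qv (q : {ffun 'I_n -> rat}) : 'cV[R]_n := \col_i ratr (q i).
rewrite (_ : _ @^-1` _ = \bigcup_(q in [set: {ffun 'I_n -> rat}])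
    [set w | F (qv q) + \sum_i `|Y i w - ratr (q i)| < c]); last first.
  apply/seteqP; split=> w /=; last first.
    move=> [q _ /= h]; rewrite in_itv /=.
    have := FL (data_vector Y w) (qv q); rewrite ler_distl => /andP[_ h1].
    have h2 := norm2_le_sum (data_vector Y w - qv q).
    apply: le_lt_trans h1 _; apply: le_lt_trans h; rewrite lerD2l.
    by apply: le_trans h2 _; apply: ler_sum => i _; rewrite !mxE.
  rewrite in_itv /= => Fc.
  pose e := (c - F (data_vector Y w)) / (2 * n.+1%:R).
  have e0 : 0 < e by rewrite divr_gt0 ?subr_gt0// mulr_gt0 ?ltr0n.
  have /choice [q Hq] : forall i : 'I_n, exists q : rat,
      `|Y i w - ratr q| < e.
    move=> i; have [|q] := @rat_in_itvoo _ (Y i w - e) (Y i w + e); first by lra.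
    rewrite in_itv /= => /andP[h1 h2]; exists q; rewrite ltr_distl; lra.
  exists (finfun q) => //=.
  have S1 : \sum_i `|Y i w - ratr (finfun q i)| <= e * n%:R.
    apply: (@le_trans _ _ (\sum_(i < n) e)).
      by apply: ler_sum => i _; rewrite ffunE ltW.
    by rewrite sumr_const card_ord mulr_natr.
  have := FL (qv (finfun q)) (data_vector Y w); rewrite ler_distl => /andP[_ h1].
  have h2 : norm2 (qv (finfun q) - data_vector Y w) <= e * n%:R.
    apply: le_trans (norm2_le_sum _) _; apply: le_trans S1; apply: ler_sum => i _.
    by rewrite !mxE distrC.
  have h3 : e * (2 * n.+1%:R) = c - F (data_vector Y w).
    by rewrite /e divfK// gt_eqF// mulr_gt0 ?ltr0n.
  have : e * (2 * n.+1%:R) = 2 * (e * n%:R) + 2 * e by rewrite -natr1; ring.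
  lra.
apply: countable_bigcupT_measurable; first exact: countableP.
move=> q; rewrite (_ : [set w | _] =
  (fun w => F (qv q) + \sum_i `|Y i w - ratr (q i)|) @^-1` `]-oo, c[); last first.
  by apply/seteqP; split=> w /=; rewrite in_itv.
rewrite -[X in measurable X]setTI.
by apply: (measurable_funD (measurable_cst _) (mY _)).
Qed.

End LipschitzMeasurability.

(** * Reduction to two deviation events *)

Section DeterministicBound.
Context {R : realType}.
Local Notation half_pow := (@half_pow R).

(** Choosing the cut-off at the nearer of the two neighbouring knots makes the norm
    a half power of the distance to the knots. *)
Lemma green_knots n k (k0 : (0 < k)%N) (kn : (k < n)%N) (S : {set 'I_(n - k)})
    (r : 'I_(n - k)) i :
  r \notin enlarged S -> (i <= #|S|)%N ->
  (knot S i < (k + r).+1 < knot S i.+1)%N ->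
  exists phi : 'cV[R]_n,
    (forall r', r' \notin enlarged S -> (diff_op R n k *m phi) r' 0 = (r' == r)%:R) /\
    norm2 phi <= half_pow k (minn ((k + r).+1 - knot S i) (knot S i.+1 - (k + r).+1)).
Proof.
move=> rE iS /andP[ir ri]; have kn' := ltnW kn.
have pwE d (phi : 'cV[R]_n) : dotv phi phi <= d%:R ^+ (2 * k - 1) -> norm2 phi <= half_pow k d.
  move=> h; rewrite -(ler_sqr (norm2_ge0 _) (half_pow_ge0 _ _)) norm2_sqr.
  by rewrite -(prednK k0) half_pow_sqrS prednK.
have [h|h] := leqP ((k + r).+1 - knot S i) (knot S i.+1 - (k + r).+1).
  have [|phi [H1 H2]] := @green_left R n k k0 kn' S r ((k + r).+1 - knot S i) rE.
    case: i iS ir {ri h} => [|i] iS ir; first by right; rewrite knot0; lia.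
    left; have [E mS] := @knotE n k S r i.+1 iS.
    by exists (nth r (enum S) i) => //; rewrite E in ir *; move: ir => /=; lia.
  by exists phi; split=> //; exact: pwE.
have [|phi [H1 H2]] := @green_right R n k k0 kn' S r (knot S i.+1 - (k + r).+1) rE.
  have [iS'|iS'] := ltnP i #|S|.
    left; have [E mS] := @knotE n k S r i.+1 iS'.
    by exists (nth r (enum S) i) => //; rewrite E in ri *; move: ri => /=; lia.
  have iE : i = #|S| by apply/eqP; rewrite eqn_leq iS.
  by right; rewrite iE knot_last; have := ltn_ord r; lia.
by exists phi; split=> //; exact: pwE.
Qed.

(** What is left to control about the noise: finitely many linear functionals, one
    for every row outside E, and the norm of its projection on a space of
    dimension at most k (s + 1). The functions phi, the basis us and the set E
    depend on the knots only, not on the data. *)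
Lemma deterministic_bound k : (0 < k)%N -> exists kap C : R, [/\ 0 < kap, 0 < C &
  forall n (S : {set 'I_(n - k)}), (k < n)%N ->
  exists (E : {set 'I_(n - k)}) (us : seq 'cV[R]_n)
    (phi : 'I_(n - k) -> 'cV[R]_n) (dist : 'I_(n - k) -> nat),
  [/\ S \subset E,
      orthonormal_seq us /\ (size us <= k * #|S|.+1)%N,
      (0 < gap_max S)%N,
      (forall r, r \notin E -> (0 < dist r)%N /\ norm2 (phi r) <= half_pow k (dist r)) &
      forall (sgn : R -> R) (f f0 y fh : 'cV[R]_n) (lambda A : R),
        is_sign sgn -> 0 <= lambda -> is_tf_estimate k lambda y fh ->
        (forall r, r \notin E -> `|dotv (phi r - oproj us (phi r)) (y - f0)| <=
           n%:R * lambda * (kap * (half_pow k (dist r) / half_pow k (gap_max S)))) ->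
        norm2 (oproj us (y - f0)) <= A ->
        sqnormn (fh - f0) <= sqnormn (f - f0)
          + 4 * lambda * norm1_off S (diff_op R n k *m f)
          + (A / Num.sqrt n%:R + lambda * Gamma S sgn f C) ^+ 2]].
Proof.
move=> k0; have [kap [C [kap0 C0 Hint]]] := @interpolation R k k0.
exists kap, C; split=> // n S kn.
have kn' := ltnW kn.
pose D := diff_op R n k.
have [us [on sz Hus]] := @kernel_basis R n k k0 kn' S.
have /choice [ix Hix] : forall r : 'I_(n - k), exists i,
    (i <= #|S|)%N /\ (knot S i <= (k + r).+1 < knot S i.+1)%N.
  by move=> r; have [i iS Hi] := knot_between kn S r; exists i.
pose dist (r : 'I_(n - k)) := minn ((k + r).+1 - knot S (ix r)) (knot S (ix r).+1 - (k + r).+1).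
have SE : S \subset enlarged S.
  apply/fintype.subsetP => r rS; rewrite inE; apply/existsP; exists r.
  by rewrite rS leqnn -addn1 leq_add2l.
have notS r : r \notin enlarged S -> r \notin S.
  by apply: contra => /(fintype.subsetP SE).
have strict r : r \notin enlarged S -> (knot S (ix r) < (k + r).+1 < knot S (ix r).+1)%N.
  move=> rE; have [iS /andP[h1 ->]] := Hix r; rewrite andbT.
  exact: (knot_between_strict kn (notS r rE) iS h1).
have /choice [phi Hphi] : forall r, exists phi : 'cV[R]_n, r \notin enlarged S ->
    (forall r', r' \notin enlarged S -> (D *m phi) r' 0 = (r' == r)%:R) /\
    norm2 phi <= half_pow k (dist r).
  move=> r; have [_|rE] := boolP (r \in enlarged S); first by exists 0.
  have [iS _] := Hix r.
  by have [phi H] := green_knots k0 kn rE iS (strict r rE); exists phi.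
have M0 : (0 < gap_max S)%N.
  apply: leq_trans (gap_le_max (leq0n #|S|)); rewrite subn_gt0.
  by apply: (@knot_lt n k kn S 0%N).
exists (enlarged S), us, phi, dist; split=> //.
  move=> r rE; split; last by have [_] := Hphi r rE.
  by have := strict r rE; rewrite /dist; lia.
move=> sgn f f0 y fh lambda A hsgn l0 fhP Hw HA.
pose q i : R := if i is 0%N then 0 else knot_sign S sgn f i.
have q_sgn r i : (0 < i <= #|S|)%N -> q i = sgn ((D *m f) (nth r (enum S) i.-1) 0).
  case: i => // i iS; rewrite /q /knot_sign (nth_map r)//.
  by rewrite -cardE.
have q_default i : (#|S| < i)%N -> q i = 0.
  case: i => // i iS; rewrite /q /knot_sign nth_default//.
  by rewrite size_map -cardE.
have q_pm i : (0 < i <= #|S|)%N -> q i = 1 \/ q i = -1.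
  move=> iS; have /card_gt0P[r rS] : (0 < #|S|)%N by move: iS; lia.
  by rewrite (q_sgn r)//; have [] := hsgn ((D *m f) (nth r (enum S) i.-1) 0).
have q1 i : `|q i| <= 1.
  have [iS|] := boolP (0 < i <= #|S|)%N.
    by case: (q_pm i iS) => ->; rewrite ?normrN normr1.
  rewrite negb_and -!leqNgt -ltnNge leqn0 => /orP[/eqP ->|/q_default ->];
    by rewrite normr0.
have qsc i : (i <= #|S|)%N -> sign_change S sgn f i.+1 -> q i * q i.+1 <= 0.
  move=> iS; rewrite /sign_change => /or3P[/andP[i2 /eqP e]|/eqP [->]|/eqP [->]].
  - by case: i iS i2 e => [|i] iS i2 e; rewrite ?mul0r// mulrC /q e lerN10.
  - by rewrite mul0r.
  - by rewrite (q_default #|S|.+1)// mulr0.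
have qnsc i : (i <= #|S|)%N -> ~~ sign_change S sgn f i.+1 -> q i.+1 = q i.
  move=> iS; rewrite /sign_change !negb_or => /and3P[h1 h2 h3].
  have i0 : (0 < i)%N by move: h2; case: i {iS h1 h3}.
  have iS' : (i < #|S|)%N by rewrite ltn_neqAle iS andbT; apply: contra h3 => /eqP ->.
  have i2 : (2 <= i.+1 <= #|S|)%N by rewrite ltnS i0.
  have i3 : (0 < i <= #|S|)%N by rewrite i0.
  rewrite i2 /= in h1.
  have h4 : q i.+1 * q i != -1 by case: i i0 h1 {iS h2 h3 iS' i2 i3}.
  have [e1|e1] := q_pm i.+1 iS'; have [e2|e2] := q_pm i i3; rewrite e1 e2// in h4 *.
    by rewrite mul1r eqxx in h4.
  by rewrite mulr1 eqxx in h4.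
have [Z [[Z0 Zn] Zt Zb ZE]] := @Hint #|S| (knot S) q (sign_change S sgn f) (gap_max S)
  (fun i iS => knot_lt kn iS) (fun i iS => gap_le_max iS) erefl
  (q_default _ (leqnn _)) q1 qsc qnsc.
pose z : 'cV[R]_(n - k) := \col_r Z (k + r).+1.
have pM : 0 < half_pow k (gap_max S) by exact: half_pow_gt0.
pose U := \sum_(1 <= i < #|S|.+2 | sign_change S sgn f i)
        (1 + ln (gap S i)%:R) / (gap S i)%:R ^+ (2 * k - 1)
     + \sum_(1 <= i < #|S|.+2 | ~~ sign_change S sgn f i)
        (1 + ln (gap S i)%:R) / (gap_max S)%:R ^+ (2 * k - 1) : R.
have zG : norm2 (D^T *m z) <= Num.sqrt (C * U).
  rewrite /norm2 ler_wsqrtr//.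
  apply: le_trans (ZE (n + k).+1).
  rewrite /dotv (eq_bigr (fun j : 'I_n => iter k bdiff Z (j + k).+1 ^+ 2)); last first.
    move=> j _; rewrite (@trmx_diff_op_mulE R n k kn' z Z j).
    - by rewrite -expr2 exprMn -exprM mulnC exprM sqrrN expr1n expr1n mul1r.
    - by move=> r; rewrite mxE.
    - by move=> x xk; apply: Z0.
    - by move=> x nx; apply: Zn; rewrite knot_last.
  rewrite -(big_mkord xpredT (fun j => iter k bdiff Z (j + k).+1 ^+ 2)).
  rewrite [leRHS](@big_cat_nat _ _ _ k.+1)//=; last by rewrite ltnS leq_addl.
  rewrite (_ : \sum_(k.+1 <= x < (n + k).+1) _ =
      \sum_(0 <= j < n) iter k bdiff Z (j + k).+1 ^+ 2).
    by rewrite lerDr sumr_ge0// => x _; exact: sqr_ge0.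
  rewrite -[k.+1 in LHS]add0n big_addn (_ : ((n + k).+1 - k.+1 = n)%N); last by lia.
  by apply: eq_bigr => j _; rewrite addnS.
have zb r : `|z r 0| <= 1 - kap * (half_pow k (dist r) / half_pow k (gap_max S)).
  have [iS /andP[h1 h2]] := Hix r; rewrite mxE.
  by apply: Zb iS _; rewrite h1 ltnW.
have := @oracle_inequality R n k (leq_trans k0 kn') lambda f0 f y fh S (enlarged S) us phi
  (fun r => kap * (half_pow k (dist r) / half_pow k (gap_max S))) z A (Num.sqrt (C * U)) l0 fhP SE Hus.
have -> : Gamma S sgn f C = Num.sqrt n%:R * Num.sqrt (C * U).
  by rewrite -sqrtrM// mulrA.
apply.
- by move=> r r' rE; have [H _] := Hphi r rE; apply: H.
- by [].
- move=> r rS; have [i iS rE] := knot_index rS.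
  have [knE _] := @knotE n k S r i iS.
  have iS1 : (i <= #|S|)%N by have /andP[] := iS.
  rewrite mxE -[in Z _]rE -knE Zt// (q_sgn r)// rE.
  by have [_] := hsgn ((D *m f) r 0).
- move=> r; apply: le_trans (zb r) _.
  rewrite gerBl; apply: mulr_ge0; first exact: ltW.
  by apply: divr_ge0; exact: half_pow_ge0.
- by move=> r _; exact: zb.
- by [].
- by [].
Qed.

End DeterministicBound.

(** * Proof of the prediction bound *)

Section GoodEvent.
Context {R : realType} {d : measure_display} {T : measurableType d}.
Variable P : probability T R.

Lemma measurable_ge_set (g : T -> R) c : measurable_fun setT g ->
  measurable [set w | c <= g w].
Proof.
move=> mg; rewrite (_ : [set _ | _] = g @^-1` `[c, +oo[).
  by rewrite -[X in measurable X]setTI; exact: mg.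
by apply/seteqP; split=> w /=; rewrite in_itv /= andbT.
Qed.

Lemma prob_ge_of_bad (A B1 B2 : set T) (p1 p2 : R) :
  measurable A -> measurable B1 -> measurable B2 ->
  (P B1 <= p1%:E)%E -> (P B2 <= p2%:E)%E ->
  (forall w, ~ B1 w -> ~ B2 w -> A w) ->
  ((1 - p1 - p2)%:E <= P A)%E.
Proof.
move=> mA m1 m2 h1 h2 sub.
have h : (P (~` A) <= (p1 + p2)%:E)%E.
  apply: (@le_trans _ _ (P (B1 `|` B2))).
    apply: le_measure; [exact/mem_set/measurableC|exact/mem_set/measurableU|].
    move=> w Aw; apply: contrapT => nB; apply: Aw; apply: sub => Bw; apply: nB.
      by left.
    by right.
  by apply: le_trans (measureU2 _ _ _) _ => //; rewrite EFinD leeD.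
rewrite -[A]setCK probability_setC; last exact: measurableC.
by rewrite -addrA -opprD EFinB leeB.
Qed.

Lemma prob_bigsetU_le (I : finType) (Q : pred I) (B : I -> set T) (p : R) :
  (forall i, measurable (B i)) -> (forall i, Q i -> (P (B i) <= p%:E)%E) ->
  (P (\big[setU/set0]_(i | Q i) B i) <= (#|Q|%:R * p)%:E)%E.
Proof.
move=> mB hB.
have [_ H] : measurable (\big[setU/set0]_(i | Q i) B i) /\
    (P (\big[setU/set0]_(i | Q i) B i) <= \sum_(i | Q i) p%:E)%E.
  elim/big_rec2 : _ => [|i x A Qi [mA hA]]; first by rewrite measure0.
  split; first exact: measurableU.
  by apply: le_trans (measureU2 _ _ _) _ => //; rewrite leeD ?hB.
by apply: le_trans H _; rewrite sumEFin sumr_const mulr_natl.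
Qed.

End GoodEvent.

Theorem theorem1p1 (R : realType) (k : nat) (hk : (1 <= k <= 4)%N) :
  exists c C : R, 0 < c /\ 0 < C /\
  forall (n : nat) (hn : (k < n)%N) (f0 : 'cV[R]_n)
    (d : measure_display) (T : measurableType d) (P : probability T R)
    (Y : 'I_n -> {RV P >-> R}) (hY : std_gaussian_vector f0 Y)
    (S : {set 'I_(n - k)})
    (u : R) (hu : 0 < u)
    (lambda : R)
    (hlambda : c * n%:R ^+ (k - 1)
                 * ((gap_max S)%:R / (2 * n%:R)) `^ ((2 * k - 1)%:R / 2)
                 * lambda0 S u <= lambda)
    (fhat : 'cV[R]_n -> 'cV[R]_n)
    (hfhat : forall y, is_tf_estimate k lambda y (fhat y))
    (sgn : R -> R) (hsgn : is_sign sgn)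
    (f : 'cV[R]_n)
    (hgap : forall i : nat, (1 <= i <= #|S|.+1)%N -> sign_change S sgn f i ->
              (k * (k + 2) <= gap S i)%N)
    (v : R) (hv : 0 < v),
  ((1 - expR (- u) - expR (- v))%:E <=
   P [set w | (sqnormn (fhat (data_vector Y w) - f0) <=
      sqnormn (f - f0) + 4 * lambda * norm1_off S (diff_op R n k *m f)
      + (Num.sqrt ((k * #|S|.+1)%:R / n%:R) + Num.sqrt (2 * v / n%:R)
         + lambda * Gamma S sgn f C) ^+ 2)%R])%E.
Proof.
have k0 : (0 < k)%N by case/andP: hk.
have [kap [C [kap0 C0 H]]] := @deterministic_bound R k k0.
(* c is chosen so that lambda dominates t0 / (kap sqrt n) times
   M ^ (k - 1/2), see lam_key. *)
pose c : R := Num.sqrt (2 ^+ (2 * k - 1)) / kap.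
have c0 : 0 < c by rewrite divr_gt0// sqrtr_gt0 exprn_gt0.
exists c, C; do 2 split=> //.
move=> n kn f0 d T P Y hY S u u0 lambda hlambda fhat hfhat sgn hsgn f _ v v0.
have n0 : (0 < n)%N by exact: leq_trans kn.
have nR : (0 : R) < n%:R by rewrite ltr0n.
have [E [us [phi [dist [SE [on sz] M0 Hphi Hdet]]]]] := H n S kn.
pose M := gap_max S; rewrite -/M in M0 Hdet hlambda.
have l0 : 0 <= lambda.
  apply: le_trans hlambda; rewrite mulr_ge0 ?sqrtr_ge0// mulr_ge0 ?powR_ge0//.
  by rewrite mulr_ge0 ?exprn_ge0// ltW.
pose eps w := data_vector Y w - f0.
pose a r := phi r - oproj us (phi r).
pose m := (n - k - #|S|)%N.
pose t0 : R := Num.sqrt (2 * ln (2 * m%:R) + 2 * u).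
have sn0 : 0 < Num.sqrt (n%:R : R) by rewrite sqrtr_gt0.
have lamE : lambda0 S u = t0 / Num.sqrt n%:R.
  rewrite /lambda0 /t0 -/m; set x := 2 * ln _ + _.
  have [x0|x0] := leP 0 x; first by rewrite sqrtrM// sqrtrV.
  have xn : x / n%:R <= 0 by rewrite pmulr_lle0 ?invr_gt0// ltW.
  by rewrite (ler0_sqrtr xn) (ler0_sqrtr (ltW x0)) mul0r.
have lam_key x : 0 <= x -> t0 * x <= n%:R * lambda * (kap * (x / half_pow k M)).
  move=> x0; have pM : (0 : R) < half_pow k M by exact: half_pow_gt0.
  have M1 : (M%:R / (2 * n%:R)) `^ ((2 * k - 1)%:R / 2) =
      half_pow k M / (Num.sqrt (2 ^+ (2 * k - 1)) * (n%:R ^+ (k - 1) * Num.sqrt n%:R)) :> R.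
    rewrite powRrM powR_mulrn ?divr_ge0 ?mulr_ge0//.
    rewrite powR12_sqrt ?exprn_ge0 ?divr_ge0 ?mulr_ge0//.
    have -> : n%:R ^+ (k - 1) * Num.sqrt n%:R = Num.sqrt (n%:R ^+ (2 * k - 1)) :> R.
      by rewrite -half_pow_sqrt// -[in RHS](prednK k0) half_powS subn1.
    rewrite half_pow_sqrt//.
    rewrite -sqrtrM ?exprn_ge0// -exprMn expr_div_n.
    by rewrite sqrtrM ?exprn_ge0// sqrtrV// exprn_ge0// mulr_ge0.
  move: hlambda; rewrite M1 lamE => hl.
  have f0' : 0 <= n%:R * kap * x / half_pow k M.
    apply: divr_ge0; last exact: ltW.
    by apply: mulr_ge0 => //; apply: mulr_ge0; exact: ltW.
  have {hl} := ler_wpM2l f0' hl; rewrite /c.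
  have s20 : 0 < Num.sqrt (2 ^+ (2 * k - 1) : R) by rewrite sqrtr_gt0 exprn_gt0.
  have N10 : (0 : R) < n%:R ^+ (k - 1) by rewrite exprn_gt0.
  have nq : n%:R = Num.sqrt n%:R ^+ 2 :> R by rewrite sqr_sqrtr// ltW.
  move: (Num.sqrt (2 ^+ (2 * k - 1))) (n%:R ^+ (k - 1)) (half_pow k M) s20 N10 pM.
  move: (Num.sqrt n%:R) sn0 nq => q q0 -> s2 N1 p s20 N10 p0 h.
  rewrite (_ : t0 * x = q ^+ 2 * kap * x / p *
    (s2 / kap * N1 * (p / (s2 * (N1 * q))) * (t0 / q))); last first.
    by field; rewrite !gt_eqF.
  apply: le_trans h _.
  by rewrite le_eqVlt; apply/orP; left; apply/eqP; ring.
(* B1 and B2 are the exceptional events for the Green functions and for the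
   projected noise. *)
pose B r := [set w | t0 * half_pow k (dist r) <= `|dotv (a r) (eps w)|].
pose B1 := \big[setU/set0]_(r | r \notin E) B r.
pose K := (k * #|S|.+1)%N.
pose B2 := [set w | (Num.sqrt K%:R + Num.sqrt (2 * v)) ^+ 2 <=
  \sum_(x <- us) dotv x (eps w) ^+ 2].
have mB r : measurable (B r).
  apply: (measurable_ge_set (g := fun w => `|dotv (a r) (eps w)|)).
  by apply: measurableT_comp => //; exact: measurable_noise.
apply: (@prob_ge_of_bad _ _ _ _ _ B1 B2).
- rewrite (_ : [set w | _] = [set w | - (sqnormn (f - f0) + 4 * lambda * norm1_off S (diff_op R n k *m f)
      + (Num.sqrt ((k * #|S|.+1)%:R / n%:R) + Num.sqrt (2 * v / n%:R)
         + lambda * Gamma S sgn f C) ^+ 2) <= - sqnormn (fhat (data_vector Y w) - f0)]); last first.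
    by apply/seteqP; split=> w /=; rewrite lerN2.
  apply: measurable_ge_set; apply: measurableT_comp => //.
  have mf (i : 'I_n) : measurable_fun setT (fun w => fhat (data_vector Y w) i 0).
    apply: (measurable_lipschitz Y (F := fun y => fhat y i 0)) => y y'.
    have := tf_lipschitz n0 l0 (hfhat y) (hfhat y'); apply: le_trans.
    rewrite -sqrtr_sqr /norm2 ler_wsqrtr// /dotv (bigD1 i)//= !mxE -expr2 lerDl.
    by apply: sumr_ge0 => j _; rewrite -expr2 sqr_ge0.
  apply: measurable_funM => //; apply: measurable_sum => i; apply: measurable_funX.
  rewrite (_ : (fun w => _) = (fun w => fhat (data_vector Y w) i 0 - f0 i 0)).
    exact: measurable_funB.
  by apply/funext => w; rewrite !mxE.
- by apply: bigsetU_measurable => r _.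
- apply: (measurable_ge_set (g := fun w => \sum_(x <- us) dotv x (eps w) ^+ 2)).
  by apply: measurable_sum => x; apply: measurable_funX; exact: measurable_noise.
- have [E0|/card_gt0P[r0 r0E]] := posnP #|[pred r | r \notin E]|.
    rewrite /B1 big_pred0 => [|r]; last by have := card0_eq E0 r; rewrite !inE.
    by rewrite measure0 lee_fin expR_ge0.
  have cE : (#|[pred r | r \notin E]| <= m)%N.
    have e : (#|S| + #|[predC S]| = n - k)%N by rewrite cardC card_ord.
    have h : (#|[pred r | r \notin E]| <= #|[predC S]|)%N.
      apply: subset_leq_card; apply/fintype.subsetP => r; rewrite !inE.
      by apply: contra => /(fintype.subsetP SE).
    have Sn : (#|S| <= n - k)%N by have := max_card (mem S); rewrite card_ord.
    by apply: leq_trans h _; rewrite /m leq_subRL// e.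
  have m0 : (0 < m)%N by apply: leq_trans cE; apply/card_gt0P; exists r0.
  have m1 : (1 : R) <= 2 * m%:R by rewrite -natrM ler1n muln_gt0.
  have m0' : (0 : R) < 2 * m%:R by exact: lt_le_trans m1.
  have ln0 : 0 <= ln (2 * m%:R : R) by rewrite ln_ge0.
  have t0_gt0 : 0 < t0 by rewrite sqrtr_gt0; lra.
  have tE : 2 * expR (- (t0 ^+ 2 / 2)) = expR (- u) / m%:R :> R.
    rewrite sqr_sqrtr; last by lra.
    rewrite (_ : - (_ / 2) = - ln (2 * m%:R) + - u); last by field.
    rewrite expRD expRN lnK ?posrE// invfM.
    by field; rewrite pnatr_eq0 -lt0n.
  apply: le_trans (prob_bigsetU_le (p := expR (- u) / m%:R) _ _) _ => //.
    move=> r rE; rewrite -tE; have [d0 hphi] := Hphi r rE.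
    apply: noise_tail_abs => //; last exact: half_pow_gt0.
    by apply: le_trans hphi; exact: norm2_oprojC_le.
  rewrite lee_fin mulrA ler_pdivrMr ?ltr0n// mulrC ler_pM2l ?expR_gt0//.
  by rewrite ler_nat.
- exact: chi2_tail.
- move=> w nB1 nB2 /=.
  have -> : Num.sqrt ((k * #|S|.+1)%:R / n%:R) + Num.sqrt (2 * v / n%:R) =
      (Num.sqrt K%:R + Num.sqrt (2 * v)) / Num.sqrt n%:R :> R.
    have v2 : 0 <= 2 * v by rewrite mulr_ge0// ltW.
    by rewrite (sqrtrM _ v2) (@sqrtrM _ K%:R)// !sqrtrV// [RHS]mulrDl.
  apply: Hdet => //.
    move=> r rE; apply: le_trans (lam_key _ (half_pow_ge0 _ _)).
    rewrite leNgt; apply/negP => h; apply: nB1.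
    by rewrite /B1 (bigD1 r)//=; left; rewrite /B /= ltW.
  have s0 : 0 <= Num.sqrt K%:R + Num.sqrt (2 * v) :> R by rewrite addr_ge0 ?sqrtr_ge0.
  rewrite -(ler_sqr (norm2_ge0 _) s0) norm2_oproj//.
  by rewrite leNgt; apply/negP => h; apply: nB2; rewrite /B2 /= ltW.
Qed.
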